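(* By adding more steps, staircases, strips and rectangular barriers (to the step system described in the context) it is possible to create impact systems with level sets with any given genus $\geq 1$ and any number of disconnected components. The corresponding iso-energy surfaces are foliated by a finite number of families of level sets with equi-genus and equi-number of components.
   Context: The step system is the two degrees-of-freedom Hamiltonian impact system defined by the smooth separable Hamiltonian $H=H_1(q_1,p_1)+H_2(q_2,p_2)$, $H_i=\frac{p_i^2}{2}+V_i(q_i)$, on $(q_1,q_2)\in\mathbb{R}^2\setminus S$, with elastic reflections at the boundary of the step $S=\{(q_1,q_2)\,|\,q_1<q_1^{wall}\text{ and }q_2<q_2^{wall}\}$, where $q_1^{wall}\cdot q_2^{wall}\neq0$. Each potential $V_i$ is $C^\infty$, has a single simple minimum at the origin with $V_i(0)=0$, satisfies $qV_i'(q)>0$ for all $q\neq0$, and tends to infinity as $|q|\to\infty$. Additional barriers (further steps, staircases, strips, rectangular blocks) are regions in the configuration plane, from which the particle is reflected, whose boundaries are composed of finite or infinite horizontal and vertical pieces (parallel to the $q_1$ and $q_2$ axes). A step is bounded by two perpendicular rays meeting at a $\frac{3\pi}{2}$ corner. Elastic reflection sends $p_1\to-p_1$ at vertical boundary pieces and $p_2\to-p_2$ at horizontal ones, so the energies $e_i=H_i(q_i,p_i)$ are preserved. The level set $(e_1,e_2)$ of an impact system is the part of $\{H_1=e_1,\ H_2=e_2\}$ whose configuration $(q_1,q_2)$ lies in the allowed region (outside the barriers), with the boundary created by the barriers glued according to the elastic reflection rule; genus and number of components refer to the resulting glued surface. The iso-energy surface of energy $h$ consists of the level sets $(e_1,h-e_1)$.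 A family with equi-genus and equi-number of components is a family of level sets on the iso-energy surface all having the same genus and the same number of connected components. *)

(* Defs.v *)
From HB Require Import structures.
From mathcomp Require Import all_boot all_order all_algebra all_fingroup.
From mathcomp Require Import generic_quotient.
From mathcomp Require Import all_classical all_reals all_analysis.
From Stdlib Require Import Relations.

Set Implicit Arguments.
Unset Strict Implicit.
Unset Printing Implicit Defensive.

Import Order.TTheory GRing.Theory Num.Theory.
Import numFieldNormedType.Exports.

Local Open Scope classical_set_scope.
Local Open Scope ring_scope.

(* The minimum at the origin is simple, i.e. nondegenerate, by
   [potential_min]; it is the only one by [potential_sign]. *)
Record potential (R : realType) (V : R -> R) : Prop := Potential {
  potential_smooth : forall (n : nat) (x : R), derivable (derive1n n V) x 1;
  potential0 : V 0 = 0;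
  potential_min : derive1n 1 V 0 = 0 /\ 0 < derive1n 2 V 0;
  potential_sign : forall q : R, q != 0 -> 0 < q * derive1n 1 V q;
  potential_pinfty : V x @[x --> +oo] --> +oo;
  potential_ninfty : V x @[x --> -oo] --> +oo }.

Definition energy (R : realType) (V : R -> R) (q p : R) : R :=
  p ^+ 2 / 2 + V q.

(* Barriers are open subsets of the configuration plane, so that the particle
   may touch their boundary. *)
Section Barriers.
Variable R : realType.
Implicit Types (a b c d : R) (w q : R * R).

Definition ray (left : bool) a : set R :=
  if left then [set x | x < a] else [set x | a < x].

Definition step (left1 left2 : bool) w : set (R * R) :=
  ray left1 w.1 `*` ray left2 w.2.

(* Corners hidden by the other steps of a staircase are harmless, hence no
   monotonicity is required of the list of corners. *)
Inductive barrier : set (R * R) -> Prop :=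
| barrier_step left1 left2 w : barrier (step left1 left2 w)
| barrier_staircase left1 left2 (ws : seq (R * R)) : (0 < size ws)%N ->
    barrier (\bigcup_(w in [set` ws]) step left1 left2 w)
| barrier_vstrip a b : a < b -> barrier (`]a, b[ `*` setT)
| barrier_hstrip c d : c < d -> barrier (setT `*` `]c, d[)
| barrier_block a b c d : a < b -> c < d -> barrier (`]a, b[ `*` `]c, d[).

Definition frontier (B : set (R * R)) : set (R * R) := closure B `\` B°.

(* [q] lies on a vertical (resp. horizontal) piece of the boundary of [B]; a
   corner lies on one of each. *)
Definition on_vertical (B : set (R * R)) q : Prop :=
  exists a b, [/\ a < b, a <= q.2 <= b &
    forall y, a <= y <= b -> frontier B (q.1, y)].

Definition on_horizontal (B : set (R * R)) q : Prop :=
  exists a b, [/\ a < b, a <= q.1 <= b &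
    forall x, a <= x <= b -> frontier B (x, q.2)].

End Barriers.

(* A phase point is a pair ((q1, q2), (p1, p2)). *)
Section LevelSets.
Variables (R : realType) (V1 V2 : R -> R) (B : set (R * R)) (e1 e2 : R).

Definition level_set : set ((R * R) * (R * R)) :=
  [set x | [/\ energy V1 x.1.1 x.2.1 = e1, energy V2 x.1.2 x.2.2 = e2 &
               ~ B x.1]].

Definition reflected (x y : (R * R) * (R * R)) : Prop :=
  [/\ x.1 = y.1,
      y.2.1 = x.2.1 \/ (on_vertical B x.1 /\ y.2.1 = - x.2.1) &
      y.2.2 = x.2.2 \/ (on_horizontal B x.1 /\ y.2.2 = - x.2.2)].

Definition glued (x y : level_set) : bool := `[< reflected (val x) (val y) >].

Lemma reflected_sym x y : reflected x y -> reflected y x.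
Proof.
case: x y => [q [p1 p2]] [q' [p1' p2']] [/= <- h1 h2]; split=> //=.
- by case: h1 => [->|[h ->]]; [left|right; rewrite opprK].
- by case: h2 => [->|[h ->]]; [left|right; rewrite opprK].
Qed.

Lemma reflected_trans y x z : reflected x y -> reflected y z -> reflected x z.
Proof.
case: x y z => [q [p1 p2]] [q' [p1' p2']] [q'' [p1'' p2'']].
move=> [/= <- h1 h2] [/= <- k1 k2]; split=> //=.
- by case: h1 k1 => [->|[h ->]] [->|[k ->]]; [left|right|right|left; rewrite opprK].
- by case: h2 k2 => [->|[h ->]] [->|[k ->]]; [left|right|right|left; rewrite opprK].
Qed.

Lemma glued_equiv : equiv_class_of glued.
Proof.
split=> [x|x y|y x z].
- by apply/asboolP; split=> //; left.
- by apply/asboolP/asboolP; exact: reflected_sym.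
- by move=> /asboolP xy /asboolP yz; apply/asboolP; exact: reflected_trans yz.
Qed.

Canonical glued_equiv_rel := EquivRelPack glued_equiv.

Definition level_surface : topologicalType :=
  quotient_topology {eq_quot glued_equiv_rel}%qT.

End LevelSets.

(* Closed oriented surfaces are presented by gluing polygons. The directed
   sides of the polygons ("darts") form a finite type [D]; [phi] maps a side to
   the next one around its polygon, and [alpha] to the side it is glued with,
   with opposite direction. A polygon is the union of the triangles joining
   its centre to its sides; in the triangle of the dart [d], the point (r, s)
   of the unit square stands for c + r (z - c), where c is the centre and z the
   point at parameter s of the side. *)
Section Surfaces.
Variable R : realType.

Definition unit_square : set (R * R) := `[0, 1] `*` `[0, 1].

Inductive side_gluing (D : finType) (phi alpha : {perm D}) :
    D * (R * R) -> D * (R * R) -> Prop :=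
| glue_centre d s s' : unit_square (0, s) -> unit_square (0, s') ->
    side_gluing phi alpha (d, (0, s)) (d, (0, s'))
| glue_spoke d r : unit_square (r, 1) ->
    side_gluing phi alpha (d, (r, 1)) (phi d, (r, 0))
| glue_side d s : unit_square (1, s) ->
    side_gluing phi alpha (d, (1, s)) (alpha d, (1, 1 - s)).

(* [f] exhibits [C] as the space obtained from the polygons by the above
   identifications: a continuous map from a compact space onto a Hausdorff
   one is a quotient map. *)
Definition polygonal_presentation (X : topologicalType) (C : set X)
    (D : finType) (phi alpha : {perm D}) (f : D -> R * R -> X) : Prop :=
  [/\ forall d, alpha d != d /\ alpha (alpha d) = d,
      forall d, {within unit_square, continuous (f d)},
      \bigcup_d (f d @` unit_square) = C &
      forall d z d' z', unit_square z -> unit_square z' ->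
        f d z = f d' z' <->
        clos_refl_sym_trans _ (side_gluing phi alpha) (d, z) (d', z')].

(* The connected subspace [C] of [X] is a closed orientable surface of genus
   [g]: it has a polygonal presentation with V - E + F = 2 - 2 g. The start of
   [d] is also the start of [phi (alpha d)], so the vertices, edges and faces
   correspond to the cycles of [alpha * phi] (first [alpha], then [phi]),
   [alpha] and [phi]. *)
Definition has_genus (X : topologicalType) (C : set X) (g : nat) : Prop :=
  [/\ hausdorff_space X, connected C &
    exists (D : finType) (phi alpha : {perm D}) (f : D -> R * R -> X),
      polygonal_presentation C phi alpha f /\
      (#|porbits (alpha * phi)%g| + #|porbits phi| + 2 * g
         = #|porbits alpha| + 2)%N].

Definition components (X : topologicalType) : set (set X) :=
  [set connected_component setT x | x in [set: X]].
Arguments components X : clear implicits.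

(* [X] has exactly [size gs] connected components, and these are closed
   orientable surfaces whose genera are the entries of [gs]. *)
Definition has_genera (X : topologicalType) (gs : seq nat) : Prop :=
  exists C : 'I_(size gs) -> set X,
    [/\ injective C, range C = components X &
        forall i, has_genus (C i) (nth 0%N gs i)].

End Surfaces.

Section IsoEnergy.
Variables (R : realType) (V1 V2 : R -> R) (B : set (R * R)) (h : R).

(* The level sets on the iso-energy surface are parametrized by [e1]. *)
Definition leaves : set R := [set e1 | level_set V1 V2 B e1 (h - e1) !=set0].

(* A singular level set, which is not a surface and so has no genus, forms a
   family on its own. *)
Definition equi_family (J : set R) : Prop :=
  (exists gs : seq nat, forall e1, J e1 ->
     has_genera R (level_surface V1 V2 B e1 (h - e1)) gs) \/
  (exists2 e1, J = [set e1] & forall gs : seq nat,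
     ~ has_genera R (level_surface V1 V2 B e1 (h - e1)) gs).

Definition finitely_foliated : Prop :=
  exists (m : nat) (J : 'I_m -> set R),
    [/\ trivIset setT J, \bigcup_i J i = leaves & forall i, equi_family (J i)].

End IsoEnergy.

(* Main.v *)
From Stdlib Require Import Relations.
Require Import Defs.
From mathcomp Require Import all_boot all_order all_algebra all_fingroup.
From mathcomp Require Import generic_quotient.
From mathcomp Require Import all_classical all_reals all_analysis.
From mathcomp Require Import ring lra zify.

(** Where the allowed region is a rectilinear polygon, the level set consists of
    four copies of it, one for each choice of the signs of the momenta. Each
    vertical side is glued to the same side of the copy with opposite [p1], each
    horizontal side to that of the copy with opposite [p2]: by reflection if the
    side lies on a barrier, and because the momentum vanishes there if it lies
    on a turning line. For a staircase with [r] reflex corners, which has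
    [2 r + 4] sides and corners, all four copies share each corner, so that
    V - E + F = (2 r + 4) - 2 (2 r + 4) + 4 = - 2 r and the genus is [r + 1]
    ([stair_surface_genus]).

    The barriers added here hide the given step and leave of the plane only a
    quadrant in which both potentials increase, bounded from above by a
    descending staircase and cut by vertical strips into [N] parts. The turning
    points confine the particle to a rectangle [u <= E], [v <= F], and what this
    rectangle leaves of a descending staircase is again one. Hence all level sets
    of this table, except where a turning line meets a corner or a wall, are
    disjoint unions of surfaces of the above kind ([table_genera]), with at most
    [N] components of bounded genus. On an iso-energy surface this leaves
    finitely many lists of genera and finitely many exceptional values of [e1],
    each of which is a family by itself ([finitely_foliated_generic],
    [table_foliated]). With [g - 1] corners in each of the [N] parts, a rectangle
    that is large enough shows [N] surfaces of genus [g] ([comb_genera]).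

    That four copies of a staircase are presented by four polygons rests on
    radial coordinates. The staircase is star-shaped about a point below and to
    the left of all its corners ([radial_interior], [radial_surj]), and two
    points of the fans over its sides represent the same state only if the
    gluing rules already identify them ([glue_complete]). The surface is
    Hausdorff because the configuration, together with the momenta multiplied by
    functions that vanish exactly on the walls, separates its points
    ([level_surface_hausdorff]). That a point off the sides is not on a wall of
    the barrier follows from the bounds that are attained at nearby points of
    the frontier ([not_on_vertical], [not_on_horizontal]). *)

Set Implicit Arguments.
Unset Strict Implicit.
Unset Printing Implicit Defensive.

Import Order.TTheory GRing.Theory Num.Theory.
Import numFieldNormedType.Exports.

Local Open Scope ring_scope.

(** * Four copies of a rectilinear polygon *)

Lemma card_porbits_class (D K : finType) (f : {perm D}) (cls : D -> K) :
    (forall d, cls (f d) = cls d) ->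
    (forall d d', cls d = cls d' -> d' \in porbit f d) ->
    (forall k, exists d, cls d = k) ->
  #|porbits f| = #|K|.
Proof.
move=> cls_f cls_porbit cls_surj.
have cls_iter n d : cls ((f ^+ n)%g d) = cls d.
  by elim: n => [|n IH]; rewrite ?expg0 ?perm1// expgSr permM cls_f.
have porbitE d : porbit f d = [set d' | cls d' == cls d].
  apply/setP => d'; rewrite inE; apply/porbitP/eqP => [[n ->]//|e].
  by apply/porbitP/cls_porbit.
have -> : porbits f = [set [set d' | cls d' == k] | k in [set: K]].
  apply/setP => A; apply/imsetP/imsetP => [[d _ ->]|[k _ ->]].
    by exists (cls d); rewrite ?porbitE.
  by have [d dk] := cls_surj k; exists d; rewrite ?porbitE ?dk.
rewrite card_imset ?cardsT// => k k' /setP ekk'.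
by have [d dk] := cls_surj k; have := ekk' d; rewrite !inE dk eqxx => /esym/eqP.
Qed.

Section Darts.
Variable p : nat.

(** The polygon alternates horizontal and vertical sides: [(i, false)] goes from
    (x i, y i) to (x (i + 1), y i) and [(i, true)] from there to
    (x (i + 1), y (i + 1)), with indices modulo [p]. *)
Definition side : finType := ('I_p * bool)%type.
(** A copy of the polygon is named by the signs of [p1] and [p2], with [true]
    for the nonnegative ones. *)
Definition sign : finType := (bool * bool)%type.
Definition dart : finType := (side * sign)%type.

Definition next_side (k : side) : side :=
  if k.2 then (ordS k.1, false) else (k.1, true).
Definition prev_side (k : side) : side :=
  if k.2 then (k.1, false) else (ord_pred k.1, true).

Lemma next_sideK : cancel next_side prev_side.
Proof. by case=> i []; rewrite /prev_side/= ?ordSK. Qed.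

Lemma prev_sideK : cancel prev_side next_side.
Proof. by case=> i []; rewrite /next_side/= ?ord_predK. Qed.

Lemma side_cycle (A : side -> Prop) :
  (forall k, A k <-> A (next_side k)) -> forall k k', A k -> A k'.
Proof.
move=> A_next k k'; have p0 : (0 < p)%N by apply: leq_ltn_trans (ltn_ord k.1).
suff first_side : forall k, A k <-> A (Ordinal p0, false).
  by move=> /first_side Ak; apply/first_side.
move=> {k k'} [[i ltip] b]; have -> : A (Ordinal ltip, b) <-> A (Ordinal ltip, false).
  by case: b => //; rewrite [X in _ <-> X]A_next.
elim: i ltip => [|i IH] ltip.
  by rewrite (_ : Ordinal ltip = Ordinal p0); [|apply: val_inj].
rewrite -(IH (ltnW ltip)) [X in _ <-> X]A_next [X in _ <-> X]A_next /next_side/=.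
rewrite (_ : ordS _ = Ordinal ltip) //.
by apply: val_inj; rewrite /= modn_small.
Qed.

Definition flip (vertical : bool) (s : sign) : sign :=
  if vertical then (~~ s.1, s.2) else (s.1, ~~ s.2).

(** Changing the sign of one momentum mirrors the polygon, so the sides are
    followed forwards on two of the copies and backwards on the other two. *)
Definition positive (s : sign) : bool := s.1 == s.2.

Lemma flipK b : involutive (flip b).
Proof. by case: b => -[s1 s2]; rewrite /flip/= negbK. Qed.

Lemma positive_flip b s : positive (flip b s) = ~~ positive s.
Proof. by case: b s => -[[] []]. Qed.

Definition face_fun (d : dart) : dart :=
  (if positive d.2 then next_side d.1 else prev_side d.1, d.2).
Definition face_inv (d : dart) : dart :=
  (if positive d.2 then prev_side d.1 else next_side d.1, d.2).

Lemma face_funK : cancel face_fun face_inv.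
Proof.
by case=> k s; rewrite /face_inv/face_fun/=; case: positive; rewrite ?next_sideK ?prev_sideK.
Qed.

Definition edge_fun (d : dart) : dart := (d.1, flip d.1.2 d.2).

Lemma edge_funK : involutive edge_fun.
Proof. by case=> k s; rewrite /edge_fun/= flipK. Qed.

Definition face : {perm dart} := perm (can_inj face_funK).
Definition edge : {perm dart} := perm (can_inj edge_funK).

Lemma faceE d : face d = face_fun d. Proof. exact: permE. Qed.
Lemma edgeE d : edge d = edge_fun d. Proof. exact: permE. Qed.

Lemma card_sign : #|{: sign}| = 4. Proof. by rewrite card_prod card_bool. Qed.
Lemma card_side : #|{: side}| = (2 * p)%N.
Proof. by rewrite card_prod card_ord card_bool mulnC. Qed.

Lemma card_faces : (0 < p)%N -> #|porbits face| = 4.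
Proof.
move=> p0; rewrite -card_sign; apply: (card_porbits_class (cls := snd)).
- by move=> d; rewrite faceE.
- move=> [k s] [k' s'] /= <-.
  apply: (@side_cycle (fun l => (l, s) \in porbit face (k, s)) _ k); last exact: porbit_id.
  have step d : (d \in porbit face (k, s)) = (face d \in porbit face (k, s)).
    by rewrite -!eq_porbit_mem; have := porbit_perm face 1 d; rewrite expg1 => ->.
  move=> l; case: (boolP (positive s)) => ps.
    by rewrite [X in is_true X <-> _]step faceE /face_fun/= ps.
  by rewrite [X in _ <-> is_true X]step faceE /face_fun/= (negPf ps) next_sideK.
- by move=> s; exists ((Ordinal p0, false), s).
Qed.

Lemma card_edges : #|porbits edge| = (4 * p)%N.
Proof.
have -> : (4 * p = #|{: side * bool}|)%N.
  by rewrite card_prod card_side card_bool mulnAC.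
pose cls (d : dart) := (d.1, if d.1.2 then d.2.2 else d.2.1).
apply: (card_porbits_class (cls := cls)).
- by case=> -[i []] [s1 s2]; rewrite edgeE.
- move=> [k s] [k' s'] [<- ess'].
  have [->|ns] := eqVneq s' s; first exact: porbit_id.
  have -> : (k, s') = edge (k, s); last by have := mem_porbit edge 1 (k, s); rewrite expg1.
  rewrite edgeE /edge_fun/=; congr pair.
  by case: k ess' ns => i [] /=; case: s s' => [[] []] [[] []].
- by move=> [[i b] s]; exists ((i, b), (s, s)); rewrite /cls /=; case: b.
Qed.

(** Around a vertex, the sides before and after it alternate, and crossing them
    changes the signs of [p1] and [p2] in turn: four copies meet at every
    corner of the polygon. *)
Lemma card_vertices : #|porbits (edge * face)%g| = (2 * p)%N.
Proof.
rewrite -card_side.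
pose cls (d : dart) := if positive d.2 then d.1 else next_side d.1.
have vertexE d : (edge * face)%g d = face_fun (edge_fun d) by rewrite permM edgeE faceE.
apply: (card_porbits_class (cls := cls)).
- case=> k s; rewrite vertexE /face_fun/edge_fun/cls/= positive_flip.
  by case: (positive s); rewrite /= ?prev_sideK.
- suff porbit_cls d : d \in porbit (edge * face)%g (cls d, (true, true)).
    by move=> d d' e; have := porbit_cls d; rewrite e -eq_porbit_mem => /eqP ->.
  (* the number of sides to cross when turning about the corner from the copy
     [(true, true)] to the dart [d] *)
  pose n : dart -> nat := fun d =>
    match d with ((_, b), (s1, s2)) =>
      if s1 == s2 then (if s1 then 0%N else 2%N) else (if s1 == b then 1%N else 3%N) end.
  apply/porbitP; exists (n d); rewrite permX.
  case: d => -[i []] [[] []];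
    by rewrite /n /cls/= ?vertexE /face_fun/edge_fun/next_side/prev_side/= ?ordSK ?ord_predK ?ordSK.
- by move=> k; exists (k, (true, true)).
Qed.

Lemma edge_involution d : edge d != d /\ edge (edge d) = d.
Proof.
rewrite !edgeE edge_funK; split=> //.
by case: d => -[i []] [[] []]; apply/eqP => -[].
Qed.

End Darts.

Local Open Scope classical_set_scope.

(** * Staircase polygons *)

Section Radial.
Variable R : realFieldType.

Lemma contract_lt (a u b l : R) : 0 <= l < 1 -> a < b -> u <= b -> a + l * (u - a) < b.
Proof.
move=> /andP[l0 l1] ab ub.
have : 0 < (1 - l) * (b - a) by rewrite mulr_gt0 ?subr_gt0.
have : 0 <= l * (b - u) by rewrite mulr_ge0 ?subr_ge0.
lra.
Qed.

Lemma contract_gt (a u b l : R) : 0 <= l < 1 -> b < a -> b <= u -> b < a + l * (u - a).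
Proof.
move=> /andP[l0 l1] ab ub.
have : 0 < (1 - l) * (a - b) by rewrite mulr_gt0 ?subr_gt0.
have : 0 <= l * (u - b) by rewrite mulr_ge0 ?subr_ge0.
lra.
Qed.

End Radial.

Section Staircase.
Variables (R : realType) (r : nat) (x y : nat -> R).
Notation p := r.+2.
Hypothesis x_lt : forall i j, (i < j < p)%N -> x i < x j.
Hypothesis y_gt : forall i j, (i < j < p)%N -> y j < y i.

Implicit Types (q c : R * R) (k : side p) (t : R).

(** The reflex corners are the points (x i, y i) with [0 < i < r.+1]. *)
Definition stair : set (R * R) := [set q |
  [/\ x 0 <= q.1 <= x r.+1, y r.+1 <= q.2 <= y 0 &
      forall i : 'I_p, q.1 <= x i \/ q.2 <= y i]].

Definition stair_interior : set (R * R) := [set q |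
  [/\ x 0 < q.1 < x r.+1, y r.+1 < q.2 < y 0 &
      forall i : 'I_p, q.1 < x i \/ q.2 < y i]].

(** The wall above a reflex corner stops at the height of the previous corner,
    which also bounds the points of the staircase at that abscissa. *)
Definition vwall : set (R * R) := [set q |
  q.1 = x 0 \/ exists2 i : 'I_p, (0 < i)%N & q.1 = x i /\ y i <= q.2].

Definition hwall : set (R * R) := [set q |
  q.2 = y r.+1 \/ exists2 i : 'I_p, (i < r.+1)%N & q.2 = y i /\ x i <= q.1].

Definition side_point k t : R * R :=
  if k.2 then (x (ordS k.1), y k.1 + t * (y (ordS k.1) - y k.1))
  else (x k.1 + t * (x (ordS k.1) - x k.1), y k.1).

Lemma x_le i j : (i <= j < p)%N -> x i <= x j.
Proof.
by case: (ltngtP i j) => // [ij ?|<- _]; [apply/ltW/x_lt; rewrite ij|].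
Qed.

Lemma y_ge i j : (i <= j < p)%N -> y j <= y i.
Proof.
by case: (ltngtP i j) => // [ij ?|<- _]; [apply/ltW/y_gt; rewrite ij|].
Qed.

Lemma x_leP i j : (i < p)%N -> (j < p)%N -> x i <= x j -> (i <= j)%N.
Proof. by move=> ip jp; apply: contraTT; rewrite -ltnNge -ltNge => ji; apply/x_lt/andP. Qed.

Lemma y_leP i j : (i < p)%N -> (j < p)%N -> y i <= y j -> (j <= i)%N.
Proof. by move=> ip jp; apply: contraTT; rewrite -ltnNge -ltNge => ji; apply/y_gt/andP. Qed.

Lemma x_inj (i j : 'I_p) : x i = x j -> i = j.
Proof.
by move=> e; apply/val_inj/anti_leq; rewrite (@x_leP i j) ?(@x_leP j i) ?ltn_ord// e.
Qed.

Lemma y_inj (i j : 'I_p) : y i = y j -> i = j.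
Proof.
by move=> e; apply/val_inj/anti_leq; rewrite (@y_leP j i) ?(@y_leP i j) ?ltn_ord// e.
Qed.

Lemma ordS_case (i : 'I_p) :
  (i < r.+1)%N /\ ordS i = i.+1 :> nat \/ i = r.+1 :> nat /\ ordS i = 0 :> nat.
Proof.
have [ir|ri] := ltnP i r.+1; first by left; rewrite /= modn_small.
by right; have e : i = r.+1 :> nat by [have := ltn_ord i; lia]; rewrite /= e modnn.
Qed.

Lemma x_ordS_neq (i : 'I_p) : x (ordS i) - x i != 0.
Proof.
rewrite subr_eq0; case: (ordS_case i) => -[h ->]; first by rewrite gt_eqF// x_lt//; lia.
by rewrite lt_eqF// x_lt// h; lia.
Qed.

Lemma y_ordS_neq (i : 'I_p) : y (ordS i) - y i != 0.
Proof.
rewrite subr_eq0; case: (ordS_case i) => -[h ->]; first by rewrite lt_eqF// y_gt//; lia.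
by rewrite gt_eqF// y_gt// h; lia.
Qed.

Lemma side_point_h (i : 'I_p) t :
  side_point (i, false) t = (x i + t * (x (ordS i) - x i), y i).
Proof. by []. Qed.

Lemma side_point_v (i : 'I_p) t :
  side_point (i, true) t = (x (ordS i), y i + t * (y (ordS i) - y i)).
Proof. by []. Qed.

Lemma side_point_next k : side_point k 1 = side_point (next_side k) 0.
Proof. by case: k => i []; rewrite /side_point/= !mul1r mul0r addrC subrK addr0. Qed.

Lemma segment_bounds (a b t : R) : a <= b -> 0 <= t <= 1 ->
  a <= a + t * (b - a) <= b /\ a <= b + t * (a - b) <= b.
Proof.
move=> ab /andP[t0 t1].
have : 0 <= t * (b - a) by rewrite mulr_ge0 ?subr_ge0.
have : 0 <= (1 - t) * (b - a) by rewrite mulr_ge0 ?subr_ge0.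
by move=> *; split; apply/andP; split; lra.
Qed.

Lemma segment_param (a b u : R) : a < b -> a <= u <= b ->
  exists2 t, 0 <= t <= 1 & u = a + t * (b - a).
Proof.
move=> ab /andP[au ub]; have ab0 : 0 < b - a by rewrite subr_gt0.
exists ((u - a) / (b - a)); last by rewrite divfK ?gt_eqF// addrC subrK.
by rewrite divr_ge0 ?subr_ge0 ?(ltW ab)//= ler_pdivrMr// mul1r lerB.
Qed.

Lemma segment_param_rev (a b u : R) : a < b -> a <= u <= b ->
  exists2 t, 0 <= t <= 1 & u = b + t * (a - b).
Proof.
move=> ab /(segment_param ab)[t /andP[t0 t1] ->].
by exists (1 - t); [apply/andP; split; lra | ring].
Qed.

Lemma side_point_wall (i : 'I_p) b t : 0 <= t <= 1 ->
  stair (side_point (i, b) t) /\ (if b then vwall else hwall) (side_point (i, b) t).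
Proof.
case: b => t01; rewrite ?side_point_v ?side_point_h.
- case: (ordS_case i) => -[ir Si].
    rewrite Si; have :=@y_ge i i.+1 => /(_ ltac:(lia)) /segment_bounds /(_ t01)[_].
    set v := _ + _ * _ => /andP[vS vi].
    split; last by right; exists (ordS i); rewrite Si.
    split=> /=; first by rewrite !x_le//; lia.
      by rewrite (le_trans _ vS) ?(le_trans vi)// y_ge//; lia.
    move=> j; have [ij|ji] := ltnP i j; first by left; rewrite x_le//= ltn_ord ij.
    by right; rewrite (le_trans vi)// y_ge//= ji ltn_ord.
  rewrite Si; have := @y_ge 0 i => /(_ ltac:(lia)) /segment_bounds /(_ t01)[+ _].
  set v := _ + _ * _ => vi; split; last by left.
  split=> /=; [by rewrite lexx x_le//; lia | by rewrite -ir | ].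
  by move=> j; left; rewrite x_le//= ltn_ord.
- case: (ordS_case i) => -[ir Si].
    rewrite Si; have := @x_le i i.+1 => /(_ ltac:(lia)) /segment_bounds /(_ t01)[+ _].
    set u := _ + _ * _ => /andP[ui uS].
    split; last by right; exists i.
    split=> /=; last 1 first.
    + move=> j; have [ij|ji] := ltnP i j; first by left; rewrite (le_trans uS)// x_le//= ltn_ord ij.
      by right; rewrite y_ge//= ji ltn_ord.
    + by rewrite (le_trans _ ui) ?(le_trans uS)// x_le//; lia.
    + by rewrite !y_ge//; lia.
  rewrite Si; have := @x_le 0 i => /(_ ltac:(lia)) /segment_bounds /(_ t01)[_].
  set u := _ + _ * _ => ui; split; last by left; rewrite /= ir.
  split=> /=; [by rewrite -ir | by rewrite ir lexx y_ge//; lia | ].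
  by move=> j; right; rewrite ir y_ge// -ltnS ltn_ord /=.
Qed.

Lemma wall_side_point (q : R * R) (b : bool) :
  stair q -> (if b then vwall else hwall) q ->
  exists i, exists2 t, 0 <= t <= 1 & q = side_point (i, b) t.
Proof.
case: q b => u v [] [/= ux vy qxy].
- move=> [/= ->|[i i0 /= [eu yi]]].
    have [t t01 ->] := segment_param (@y_gt 0 r.+1 ltac:(lia)) vy.
    exists ord_max, t => //; rewrite side_point_v.
    by case: (ordS_case ord_max) => -[h ->]; [rewrite ltnn in h|].
  have Si : ordS (ord_pred i) = i by rewrite ord_predK.
  case: (ordS_case (ord_pred i)); rewrite Si => -[hr hi]; last by rewrite hi in i0.
  have vi : v <= y (ord_pred i).
    case: (qxy (ord_pred i)) => [h|//]; rewrite eu in h.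
    have := x_leP (ltn_ord _) (ltn_ord _) h; lia.
  have [||t t01 ->] := @segment_param_rev (y i) (y (ord_pred i)) v _.
  - by rewrite y_gt// ltn_ord andbT [X in (_ < X)%N]hi.
  - by rewrite yi.
  by exists (ord_pred i), t => //; rewrite side_point_v Si eu.
- move=> [/= ->|[i i0 /= [ev yi]]].
    have [t t01 ->] := segment_param_rev (@x_lt 0 r.+1 ltac:(lia)) ux.
    exists ord_max, t => //; rewrite side_point_h.
    by case: (ordS_case ord_max) => -[h ->]; [rewrite ltnn in h|].
  case: (ordS_case i) => -[hr hi]; last by rewrite hr ltnn in i0.
  have ui : u <= x (ordS i).
    case: (qxy (ordS i)) => [//|h]; rewrite ev in h.
    have := y_leP (ltn_ord _) (ltn_ord _) h; lia.
  have [||t t01 ->] := @segment_param (x i) (x (ordS i)) u.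
  - by rewrite x_lt// hi ltnSn /=.
  - by rewrite yi.
  by exists i, t => //; rewrite side_point_h ev.
Qed.

(** The abscissa of a vertical side that meets the horizontal side [i] lies
    between two consecutive values of [x], which leaves two sides; at the
    bottom, where this bound is void, the heights decide instead. *)
Lemma side_point_adjacent (i j : 'I_p) t t' : 0 <= t <= 1 -> 0 <= t' <= 1 ->
  side_point (i, false) t = side_point (j, true) t' ->
  (i = j /\ t = 1 /\ t' = 0) \/ (i = ordS j /\ t = 0 /\ t' = 1).
Proof.
move=> t01 t'01; rewrite side_point_h side_point_v => /pair_equal_spec[ex ey].
have [ij|ij] : i = j \/ i = ordS j.
  case: (ordS_case i) => -[ir Si].
    have := segment_bounds (@x_le i i.+1 ltac:(lia)) t01; rewrite -Si ex => -[/andP[h1 h2] _].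
    have {}h1 := x_leP (ltn_ord _) (ltn_ord _) h1.
    have {}h2 := x_leP (ltn_ord _) (ltn_ord _) h2.
    have [e|e] : ordS j = i :> nat \/ ordS j = ordS i :> nat by lia.
      by right; apply/val_inj/esym.
    by left; apply/(can_inj (@ordSK _))/val_inj/esym.
  case: (ordS_case j) => -[jr Sj]; last by left; apply/val_inj; rewrite /= ir jr.
  have := segment_bounds (@y_ge j j.+1 ltac:(lia)) t'01; rewrite -Sj -ey => -[_ /andP[h1 _]].
  have {}h1 := y_leP (ltn_ord _) (ltn_ord _) h1.
  right; apply/val_inj; change (i = ordS j :> nat); lia.
- subst j; left; split=> //; split.
    apply: (mulIf (x_ordS_neq i)); lra.
  by apply: (mulIf (y_ordS_neq i)); lra.
- right; split=> //; split.
    by apply: (mulIf (x_ordS_neq i)); move: ex; rewrite ij; lra.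
  by apply: (mulIf (y_ordS_neq j)); move: ey; rewrite ij; lra.
Qed.

Definition same_boundary_point k t k' t' :=
  [\/ k = k' /\ t = t', next_side k = k' /\ t = 1 /\ t' = 0 |
      next_side k' = k /\ t' = 1 /\ t = 0].

Lemma side_point_eq k t k' t' : 0 <= t <= 1 -> 0 <= t' <= 1 ->
  side_point k t = side_point k' t' -> same_boundary_point k t k' t'.
Proof.
case: k k' => [i []] [j []] t01 t'01.
- rewrite !side_point_v => /pair_equal_spec[/x_inj eij ey].
  have e : i = j by apply: (can_inj (@ordSK _)).
  subst j; constructor 1; split=> //.
  by apply: (mulIf (y_ordS_neq i)); lra.
- move=> /esym/(side_point_adjacent t'01 t01)[[<- [-> ->]]|[-> [-> ->]]].
    by constructor 3.
  by constructor 2.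
- move=> /(side_point_adjacent t01 t'01)[[<- [-> ->]]|[-> [-> ->]]].
    by constructor 2.
  by constructor 3.
- rewrite !side_point_h => -[ex /y_inj eij]; subst j; constructor 1; split=> //.
  by apply: (mulIf (x_ordS_neq i)); lra.
Qed.

Lemma interior_not_wall q : stair_interior q -> ~ vwall q /\ ~ hwall q.
Proof.
case: q => u v [/= /andP[ux0 ux1] /andP[vy0 vy1] qxy].
split=> -[/= e|[i i0 /= [e h]]].
- by rewrite e ltxx in ux0.
- by case: (qxy i); rewrite ?e ?ltxx // ltNge h.
- by rewrite e ltxx in vy0.
- by case: (qxy i); rewrite ?e ?ltxx // ltNge h.
Qed.

Lemma stair_boundary q : stair q -> ~ stair_interior q -> vwall q \/ hwall q.
Proof.
case: q => u v [/= /andP[ux0 ux1] /andP[vy0 vy1] qxy] nint; apply: contrapT => /not_orP[nv nh].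
apply: nint; split=> /=.
- rewrite !lt_neqAle ux0 ux1 !andbT; apply/andP; split.
    by apply/negP => /eqP e; apply: nv; left.
  by apply/negP => /eqP e; apply: nv; right; exists ord_max.
- rewrite !lt_neqAle vy0 vy1 !andbT; apply/andP; split.
    by apply/negP => /eqP e; apply: nh; left.
  by apply/negP => /eqP e; apply: nh; right; exists ord0.
move=> i; have [ui|iu] := ltP u (x i); first by left.
have [vi|iv] := ltP v (y i); first by right.
case: (qxy i) => h.
  have ei : u = x i by apply/le_anti; rewrite h iu.
  have [i0|i0] := ltnP 0 i; first by case: nv; right; exists i.
  by case: nv; left; rewrite ei; congr x; lia.
have ei : v = y i by apply/le_anti; rewrite h iv.
have [i0|i0] := ltnP i r.+1; first by case: nh; right; exists i.
by case: nh; left; rewrite /= ei; congr y; have := ltn_ord i; lia.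
Qed.

Variable c : R * R.
Hypothesis c_x : x 0 < c.1 < x 1.
Hypothesis c_y : y r.+1 < c.2 < y r.

Let c_x_lt (i : 'I_p) : (0 < i)%N -> c.1 < x i.
Proof. by move: c_x => /andP[_ c1] i0; rewrite (lt_le_trans c1)// x_le// i0 ltn_ord. Qed.

Let c_y_lt (i : 'I_p) : (i < r.+1)%N -> c.2 < y i.
Proof. by move: c_y => /andP[_ c1] i0; rewrite (lt_le_trans c1)// y_ge//; lia. Qed.

Definition radial t q : R * R := (c.1 + t * (q.1 - c.1), c.2 + t * (q.2 - c.2)).

Lemma radial1 q : radial 1 q = q.
Proof. by case: q => u v; rewrite /radial/= !mul1r !(addrC _ (_ - _)) !subrK. Qed.

(** The centre lies to the left of the corners with [i > 0] and below those with
    [i < r.+1], so moving towards it makes every bound strict, whichever of the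
    two alternatives of a corner holds. *)
Lemma radial_interior q t : 0 <= t < 1 -> stair q -> stair_interior (radial t q).
Proof.
case: q => u v t01 [/= /andP[ux0 ux1] /andP[vy0 vy1] qxy].
move: c_x c_y => /andP[c0 c1] /andP[c2 c3].
have ux : c.1 + t * (u - c.1) < x r.+1 by apply: contract_lt => //; apply: (c_x_lt (i := ord_max)).
have vy : c.2 + t * (v - c.2) < y 0 by apply: contract_lt => //; apply: (c_y_lt (i := ord0)).
split=> /=; rewrite ?ux ?vy ?andbT ?contract_gt//.
move=> i; case: (qxy i) => h.
  have [i0|i0] := ltnP 0 i; first by left; apply: contract_lt => //; apply: c_x_lt.
  have ei : i = 0 :> nat by apply/eqP; rewrite -leqn0.
  by right; rewrite /= ei; exact: vy.
have [i0|i0] := ltnP i r.+1; first by right; apply: contract_lt => //; apply: c_y_lt.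
have ei : i = r.+1 :> nat by apply/anti_leq; rewrite -ltnS ltn_ord i0.
by left; rewrite /= ei; exact: ux.
Qed.

(** [gauge_of q j <= t] says that [q] satisfies the bound [j] of the staircase
    dilated by [t] about the centre; the maximum over [j] is the Minkowski gauge
    of [q]. *)
Let gauge_of q (j : bool + 'I_p) : R :=
  match j with
  | inl true => (c.1 - q.1) / (c.1 - x 0)
  | inl false => (c.2 - q.2) / (c.2 - y r.+1)
  | inr i => if i == ord0 then (q.2 - c.2) / (y 0 - c.2) else
             if i == ord_max then (q.1 - c.1) / (x r.+1 - c.1) else
             Num.min ((q.1 - c.1) / (x i - c.1)) ((q.2 - c.2) / (y i - c.2))
  end.

Let gauge_ofP q t (z := radial t^-1 q) : 0 < t ->
  ((forall j, gauge_of q j <= t) <-> stair z) /\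
  (stair_interior z -> forall j, gauge_of q j < t).
Proof.
move=> t0.
have gle w d : 0 < d -> (w / d <= t) = (t^-1 * w <= d).
  by move=> d0; rewrite ler_pdivrMr// ler_pdivrMl.
have glt w d : 0 < d -> (w / d < t) = (t^-1 * w < d).
  by move=> d0; rewrite ltr_pdivrMr// ltr_pdivrMl.
have x0 : 0 < c.1 - x 0 by rewrite subr_gt0; case/andP: c_x.
have y0 : 0 < c.2 - y r.+1 by rewrite subr_gt0; case/andP: c_y.
have xm : 0 < x r.+1 - c.1 by rewrite subr_gt0 (c_x_lt (i := ord_max)).
have ym : 0 < y 0 - c.2 by rewrite subr_gt0 (c_y_lt (i := ord0)).
have xi (i : 'I_p) : i != ord0 -> 0 < x i - c.1 by move=> i0; rewrite subr_gt0 c_x_lt// lt0n.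
have yi (i : 'I_p) : i != ord_max -> 0 < y i - c.2.
  move=> i0; rewrite subr_gt0 c_y_lt//.
  by rewrite ltn_neqAle -ltnS ltn_ord andbT.
rewrite /z /stair /stair_interior /radial/=.
have neg d : t^-1 * (- d) = - (t^-1 * d) by rewrite mulrN.
split; first split.
- move=> h; have := h (inl true); have := h (inl false); have := h (inr ord0).
  have := h (inr ord_max); rewrite /= eqxx !gle// -(opprB q.1) -(opprB q.2) !neg => h1 h2 h3 h4.
  split; [apply/andP; split; lra | apply/andP; split; lra | move=> i].
  have [->|i0] := eqVneq i ord0; first by right=> /=; lra.
  have [->|im] := eqVneq i ord_max; first by left=> /=; lra.
  have := h (inr i); rewrite /= (negPf i0) (negPf im) ge_min !gle ?xi ?yi//.
  by move=> /orP[]; [left|right]; lra.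
- move=> [/andP[h1 h2] /andP[h3 h4] h] [[]|i] /=.
  + by rewrite gle// -(opprB q.1) neg; lra.
  + by rewrite gle// -(opprB q.2) neg; lra.
  + case: eqVneq => [_|i0]; first by rewrite gle//; lra.
    case: eqVneq => [_|im]; first by rewrite gle//; lra.
    rewrite ge_min !gle ?xi ?yi//; apply/orP.
    by case: (h i); [left|right]; lra.
- move=> [/andP[h1 h2] /andP[h3 h4] h] [[]|i] /=.
  + by rewrite glt// -(opprB q.1) neg; lra.
  + by rewrite glt// -(opprB q.2) neg; lra.
  + case: eqVneq => [_|i0]; first by rewrite glt//; lra.
    case: eqVneq => [_|im]; first by rewrite glt//; lra.
    rewrite gt_min !glt ?xi ?yi//; apply/orP.
    by case: (h i); [left|right]; lra.
Qed.

(** Divided by its gauge, a point moves along its ray to where some bound is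
    attained, hence to a side. *)
Lemma radial_surj q : stair q -> q <> c ->
  exists2 t, 0 < t <= 1 & exists k, exists2 s, 0 <= s <= 1 & q = radial t (side_point k s).
Proof.
move=> qS qc.
pose j := [arg max_(j > inl true) gauge_of q j]%O; pose t := gauge_of q j.
have gauge_le i : gauge_of q i <= t.
  by rewrite /t /j; case: arg_maxP => //= k _; apply.
have t0 : 0 < t.
  have gauge_pos i : 0 < gauge_of q i -> 0 < t by move=> /lt_le_trans; apply.
  have [u0|u0|u0] := ltgtP q.1 c.1.
  - apply: (gauge_pos (inl true)); rewrite /= divr_gt0 ?subr_gt0//.
    by case/andP: c_x.
  - apply: (gauge_pos (inr ord_max)); rewrite /= eqxx divr_gt0 ?subr_gt0//.
    exact: (c_x_lt (i := ord_max)).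
  - have [v0|v0|v0] := ltgtP q.2 c.2.
    + apply: (gauge_pos (inl false)); rewrite /= divr_gt0 ?subr_gt0//.
      by case/andP: c_y.
    + apply: (gauge_pos (inr ord0)); rewrite /= divr_gt0 ?subr_gt0//.
      exact: (c_y_lt (i := ord0)).
    + by case: qc; case: (q) (c) u0 v0 => a b [a' b'] /= -> ->.
have t1 : t <= 1.
  have [+ _] := gauge_ofP q (@ltr01 R); rewrite invr1 radial1.
  by move=> [_ /(_ qS)] /(_ j).
have [[/(_ gauge_le) zS _] zint] := gauge_ofP q t0.
have zn : ~ stair_interior (radial t^-1 q) by move=> /zint /(_ j); rewrite ltxx.
have qz : q = radial t (radial t^-1 q).
  rewrite /radial/= ![_ + _ - _]addrAC !subrr !add0r !mulVKf ?gt_eqF//.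
  by rewrite !(addrC _ (_ - _)) !subrK; case: (q).
exists t; rewrite ?t0//.
case: (stair_boundary zS zn) => zw.
  have [i [s s01 e]] := wall_side_point (b := true) zS zw.
  by exists (i, true), s => //; rewrite -e.
have [i [s s01 e]] := wall_side_point (b := false) zS zw.
by exists (i, false), s => //; rewrite -e.
Qed.

Lemma interior_stair : stair_interior `<=` stair.
Proof.
move=> q [/andP[h1 h2] /andP[h3 h4] h]; split; rewrite ?ltW//.
by move=> i; case: (h i) => /ltW; [left|right].
Qed.

Lemma radial_stair q t : 0 <= t <= 1 -> stair q -> stair (radial t q).
Proof.
move=> /andP[t0]; rewrite le_eqVlt => /predU1P[->|t1] qS; first by rewrite radial1.
by apply: interior_stair; apply: radial_interior; rewrite ?t0.
Qed.

(** Of two boundary points on the same ray, the nearer one would be interior. *)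
Lemma radial_inj t t' q q' : 0 <= t -> 0 <= t' ->
    stair q -> ~ stair_interior q -> stair q' -> ~ stair_interior q' ->
  radial t q = radial t' q' -> t = t' /\ (0 < t -> q = q').
Proof.
have lt_absurd s s' z z' : 0 <= s -> s < s' -> stair z -> ~ stair_interior z' ->
    radial s z <> radial s' z'.
  move=> s0 ss' zS z'n e; apply: z'n; have s'0 := le_lt_trans s0 ss'.
  have -> : z' = radial (s / s') z.
    case: z z' {zS} e => u v [u' v']; rewrite /radial/= => /pair_equal_spec[e1 e2].
    congr pair; apply: (mulfI (lt0r_neq0 s'0));
      rewrite mulrDr mulrA (mulrCA s') divff ?lt0r_neq0// mulr1; lra.
  by apply: radial_interior; rewrite // divr_ge0 ?(ltW s'0)//= ltr_pdivrMr// mul1r.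
move=> t0 t'0 qS qn q'S q'n e; have [tt'|tt'|tt'] := ltgtP t t'.
- by case: (lt_absurd _ _ _ _ t0 tt' qS q'n e).
- by case: (lt_absurd _ _ _ _ t'0 tt' q'S qn (esym e)).
split=> // tpos; subst t'; case: q q' {qS qn q'S q'n} e => u v [u' v'].
rewrite /radial/= => /pair_equal_spec[/addrI/(mulfI (lt0r_neq0 tpos))/addIr ->].
by move=> /addrI/(mulfI (lt0r_neq0 tpos))/addIr ->.
Qed.

Lemma side_point_boundary k t : 0 <= t <= 1 ->
  stair (side_point k t) /\ ~ stair_interior (side_point k t).
Proof.
case: k => i b t01; have [sS sw] := side_point_wall i b t01.
by split=> // /interior_not_wall[]; case: b sw {sS}.
Qed.

(** ** Identifications between the four copies *)

(** Sides are parametrized backwards on the copies that are followed backwards. *)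
Definition orient (s : sign) t : R := if positive s then t else 1 - t.

Notation glue := (clos_refl_sym_trans _ (side_gluing (face p) (edge p))).

Definition chart_point (k : side p) (s : sign) (t u : R) : dart p * (R * R) :=
  ((k, s), (t, orient s u)).

Lemma orient01 s t : 0 <= t <= 1 -> 0 <= orient s t <= 1.
Proof. by rewrite /orient; case: positive => // /andP[h1 h2]; apply/andP; split; lra. Qed.

Lemma orientK s : involutive (orient s).
Proof. by move=> t; rewrite /orient; case: positive => //; ring. Qed.

Lemma in_unit_square (a b : R) : 0 <= a <= 1 -> 0 <= b <= 1 -> unit_square (a, b).
Proof. by move=> ha hb; split; rewrite /= in_itv. Qed.

Lemma glue_chart_centre k s u u' : 0 <= u <= 1 -> 0 <= u' <= 1 ->
  glue (chart_point k s 0 u) (chart_point k s 0 u').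
Proof.
by move=> h h'; apply/rst_step/glue_centre; apply: in_unit_square; rewrite ?lexx ?ler01 ?orient01.
Qed.

Lemma glue_chart_spoke k s t : 0 <= t <= 1 ->
  glue (chart_point k s t 1) (chart_point (next_side k) s t 0).
Proof.
move=> t01; have sq : unit_square (t, 1 : R) by apply: in_unit_square; rewrite ?lexx ?ler01.
rewrite /chart_point /orient; case: (boolP (positive s)) => ps.
  apply: rst_step; have := glue_spoke (face p) (edge p) (k, s) sq.
  by rewrite faceE /face_fun/= ps.
apply/rst_sym/rst_step; have := glue_spoke (face p) (edge p) (next_side k, s) sq.
by rewrite faceE /face_fun/= (negPf ps) next_sideK subrr subr0.
Qed.

Lemma glue_chart_side k s u : 0 <= u <= 1 ->
  glue (chart_point k s 1 u) (chart_point k (flip k.2 s) 1 u).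
Proof.
move=> u01; have sq : unit_square (1 : R, orient s u).
  by apply: in_unit_square; rewrite ?lexx ?ler01 ?orient01.
apply: rst_step; have := glue_side (face p) (edge p) (k, s) sq.
rewrite edgeE /edge_fun/= /chart_point.
suff -> : 1 - orient s u = orient (flip k.2 s) u by [].
by rewrite /orient positive_flip; case: positive => //=; ring.
Qed.

Lemma glue_slide k k' s t u u' : 0 <= t <= 1 -> 0 <= u <= 1 -> 0 <= u' <= 1 ->
  side_point k u = side_point k' u' ->
  glue (chart_point k s t u) (chart_point k' s t u').
Proof.
move=> t01 u01 u'01 /(side_point_eq u01 u'01)[[<- <-]|[<- [-> ->]]|[<- [-> ->]]].
- exact: rst_refl.
- exact: glue_chart_spoke.
- exact/rst_sym/glue_chart_spoke.
Qed.

Lemma glue_fan k k' s u u' : 0 <= u <= 1 -> 0 <= u' <= 1 ->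
  glue (chart_point k s 0 u) (chart_point k' s 0 u').
Proof.
move=> u01 u'01; have c01 (v : R) : v = 0 \/ v = 1 -> 0 <= v <= 1.
  by case=> ->; rewrite lexx ler01.
apply: rst_trans; last by apply: (glue_chart_centre k' s (c01 0 (or_introl erefl)) u'01).
apply: (@side_cycle p (fun l => glue (chart_point k s 0 u) (chart_point l s 0 0)) _ k); last first.
  by apply: glue_chart_centre => //; apply: c01; left.
move=> l; have step : glue (chart_point l s 0 0) (chart_point (next_side l) s 0 0).
  apply: rst_trans (glue_chart_spoke l s (c01 0 (or_introl erefl))).
  by apply: glue_chart_centre; apply: c01; [left|right].
by split=> h; apply: rst_trans h _; [exact: step|exact: rst_sym].
Qed.

(** At an end of the side [k] the wall may belong to the adjacent side; the point
    is then passed to that side before it is reflected. *)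
Lemma glue_flip (b : bool) k s u : 0 <= u <= 1 ->
  (if b then vwall else hwall) (side_point k u) ->
  glue (chart_point k s 1 u) (chart_point k (flip b s) 1 u).
Proof.
move=> u01 /(wall_side_point (side_point_boundary k u01).1)[i [t t01 e]].
have one01 : 0 <= (1 : R) <= 1 by rewrite lexx ler01.
apply: rst_trans (glue_slide s one01 u01 t01 e) _.
apply: rst_trans (glue_chart_side (i, b) s t01) _.
exact: (glue_slide _ one01 t01 u01 (esym e)).
Qed.

(** Equal configurations have the same radius and, away from the centre, the same
    boundary point, which is on one side or two adjacent ones. The signs can
    differ only at radius 1, where the momenta are reflected one at a time. *)
Lemma glue_complete k k' s s' t t' u u' (q := radial t (side_point k u)) :
    0 <= t <= 1 -> 0 <= t' <= 1 -> 0 <= u <= 1 -> 0 <= u' <= 1 ->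
    q = radial t' (side_point k' u') ->
    s.1 = s'.1 \/ vwall q -> s.2 = s'.2 \/ hwall q ->
  glue (chart_point k s t u) (chart_point k' s' t' u').
Proof.
move=> t01 t'01 u01 u'01 e s1 s2.
have [bS bn] := side_point_boundary k u01; have [b'S b'n] := side_point_boundary k' u'01.
have /andP[t0 _] := t01; have /andP[t'0 _] := t'01.
have [ett' ekk'] := radial_inj t0 t'0 bS bn b'S b'n e; subst t'.
have same_sign : t < 1 -> s = s'.
  move=> t1; have /interior_not_wall[nv nh] : stair_interior q.
    by apply: radial_interior; rewrite ?t0.
  by case: s s' s1 s2 => s1 s2 [s1' s2'] /= [->|//] [->|//].
move: t0; rewrite le_eqVlt => /predU1P[t0|tpos].
  by rewrite -same_sign -t0 ?ltr01//; apply: glue_fan.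
have {}ekk' := ekk' tpos; apply: (rst_trans _ _ _ (chart_point k s' t u)); last exact: glue_slide.
have [t1|t1] := ltP t 1; first by rewrite same_sign//; apply: rst_refl.
have et : t = 1 by apply/le_anti; rewrite t1; case/andP: t01 => _ ->.
move: s1 s2; rewrite /q et radial1 {same_sign}.
case: s => s1 s2; case: s' => s1' s2' /= h1 h2.
apply: (rst_trans _ _ _ (chart_point k (s1', s2) 1 u)).
  have [<-|n1] := eqVneq s1 s1'; first exact: rst_refl.
  case: h1 n1 => [->|w n1]; first by rewrite eqxx.
  by have := glue_flip (b := true) (s1, s2) u01 w; rewrite /flip/=; case: s1 s1' n1 {h2} => [] [].
have [<-|n2] := eqVneq s2 s2'; first exact: rst_refl.
case: h2 n2 => [->|w n2]; first by rewrite eqxx.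
by have := glue_flip (b := false) (s1', s2) u01 w; rewrite /flip/=; case: s2 s2' n2 {h1} => [] [].
Qed.

End Staircase.

(** * Level surfaces *)

Lemma continuous_pair (T U W : topologicalType) (f : T -> U) (h : T -> W) :
  continuous f -> continuous h -> continuous (fun x => (f x, h x)).
Proof. by move=> cf ch x; apply: cvg_pair; [apply: cf|apply: ch]. Qed.

Lemma continuous_compose (T U W : topologicalType) (h : U -> W) (f : T -> U) :
  continuous h -> continuous f -> continuous (fun x => h (f x)).
Proof. by move=> ch cf x; apply: (continuous_comp (cf x) (ch (f x))). Qed.

Lemma continuous_fst (U W : topologicalType) : continuous (@fst U W).
Proof. by move=> x; apply: cvg_fst. Qed.

Lemma continuous_snd (U W : topologicalType) : continuous (@snd U W).
Proof. by move=> x; apply: cvg_snd. Qed.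

Section RealContinuity.
Variables (R : realType) (T : topologicalType).
Implicit Types f h : T -> R.

Lemma continuous_add f h : continuous f -> continuous h -> continuous (fun x => f x + h x).
Proof. by move=> cf ch x; apply: cvgD; [apply: cf|apply: ch]. Qed.

Lemma continuous_sub f h : continuous f -> continuous h -> continuous (fun x => f x - h x).
Proof. by move=> cf ch x; apply: cvgB; [apply: cf|apply: ch]. Qed.

Lemma continuous_mul f h : continuous f -> continuous h -> continuous (fun x => f x * h x).
Proof. by move=> cf ch x; apply: cvgM; [apply: cf|apply: ch]. Qed.

Lemma continuous_const (a : R) : continuous (fun _ : T => a).
Proof. by move=> x; apply: cvg_cst. Qed.

End RealContinuity.

Lemma hausdorff_injective (X Y : topologicalType) (f : X -> Y) :
  continuous f -> injective f -> hausdorff_space Y -> hausdorff_space X.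
Proof.
move=> cf f_inj; rewrite !open_hausdorff => hY a b ab.
have fab : f a != f b by apply: contra_neq ab => /f_inj.
have [[U W] /= []] := hY _ _ fab; rewrite !inE => aU bW [oU oW UW].
exists (f @^-1` U, f @^-1` W); rewrite /= ?inE; first by [].
move/continuousP in cf; split; [exact: cf|exact: cf|].
by apply/eqP; rewrite -preimage_setI UW preimage_set0.
Qed.

Section LevelSurface.
Variables (R : realType) (V1 V2 : R -> R) (B : set (R * R)) (e1 e2 : R).
Hypotheses (cV1 : continuous V1) (cV2 : continuous V2).
Notation L := (level_set V1 V2 B e1 e2).
Notation X := (level_surface V1 V2 B e1 e2).

Definition surface_pt (a : L) : X :=
  (\pi_(quotient_topology {eq_quot glued_equiv_rel V1 V2 B e1 e2}) a)%qT.

Lemma surface_pt_continuous : continuous surface_pt.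
Proof. exact: pi_continuous. Qed.

Lemma surface_pt_eq (a b : L) : surface_pt a = surface_pt b <-> reflected B (val a) (val b).
Proof.
split=> [|ab]; first by move=> /eqquotP/asboolP.
by apply/eqquotP/asboolP.
Qed.

Lemma surface_pt_surj (z : X) : exists a, z = surface_pt a.
Proof. by exists (repr z); rewrite /surface_pt reprK. Qed.

Lemma level_val_continuous : continuous (val : L -> (R * R) * (R * R)).
Proof. exact: initial_continuous. Qed.

Lemma level_valP (a : L) : level_set V1 V2 B e1 e2 (val a).
Proof. exact: set_valP. Qed.

Lemma kinetic (V : R -> R) e q p1 p2 : energy V q p1 = e -> energy V q p2 = e ->
  p2 = p1 \/ p2 = - p1.
Proof.
rewrite /energy => h1 h2; have /eqP : p2 ^+ 2 = p1 ^+ 2 by lra.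
by rewrite eqf_sqr => /orP[] /eqP; [left|right].
Qed.

(** The momenta are not functions on the surface, since a reflection changes
    their signs; multiplied by functions that vanish exactly on the walls,
    they become so and still separate points. *)
Lemma level_surface_hausdorff (w1 w2 : R * R -> R) :
    continuous w1 -> continuous w2 ->
    (forall a : L, on_vertical B (val a).1 -> w1 (val a).1 = 0) ->
    (forall a : L, on_horizontal B (val a).1 -> w2 (val a).1 = 0) ->
    (forall a : L, w1 (val a).1 = 0 -> on_vertical B (val a).1 \/ (val a).2.1 = 0) ->
    (forall a : L, w2 (val a).1 = 0 -> on_horizontal B (val a).1 \/ (val a).2.2 = 0) ->
  hausdorff_space X.
Proof.
move=> cw1 cw2 v1 v2 u1 u2.
pose f (a : L) := ((val a).1, ((val a).2.1 * w1 (val a).1, (val a).2.2 * w2 (val a).1)).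
have cf : continuous f.
  have cq : continuous (fun a : L => (val a).1).
    exact: (continuous_compose (@continuous_fst _ _) level_val_continuous).
  have cp : continuous (fun a : L => (val a).2).
    exact: (continuous_compose (@continuous_snd _ _) level_val_continuous).
  apply: continuous_pair => //; apply: continuous_pair; apply: continuous_mul.
  - exact: (continuous_compose (@continuous_fst _ _) cp).
  - exact: (continuous_compose cw1 cq).
  - exact: (continuous_compose (@continuous_snd _ _) cp).
  - exact: (continuous_compose cw2 cq).
have f_surface_pt a b : surface_pt a = surface_pt b -> f a = f b.
  move=> /surface_pt_eq[eq h1 h2]; rewrite /f -eq; congr (_, (_, _)).
    by case: h1 => [->//|[/v1 -> _]]; rewrite !mulr0.
  by case: h2 => [->//|[/v2 -> _]]; rewrite !mulr0.
have f_inj a b : f a = f b -> surface_pt a = surface_pt b.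
  move=> /pair_equal_spec[eq /pair_equal_spec[h1 h2]]; apply/surface_pt_eq; split=> //.
    have [a1 _ _] := level_valP a; have [b1 _ _] := level_valP b; rewrite -eq in b1.
    have [->|e] := kinetic a1 b1; first by left.
    have [/u1[ov|p0]|nz] := eqVneq (w1 (val a).1) 0; first by right.
      by left; rewrite e p0 oppr0.
    by left; apply/esym/(mulIf nz); rewrite h1 -eq.
  have [_ a1 _] := level_valP a; have [_ b1 _] := level_valP b; rewrite -eq in b1.
  have [->|e] := kinetic a1 b1; first by left.
  have [/u2[ov|p0]|nz] := eqVneq (w2 (val a).1) 0; first by right.
    by left; rewrite e p0 oppr0.
  by left; apply/esym/(mulIf nz); rewrite h2 -eq.
apply: (@hausdorff_injective _ _ (f \o repr : X -> _)).
- apply: repr_comp_continuous cf _ => a b /eqP ab; apply/eqP/f_surface_pt; exact: ab.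
- move=> a b /= /f_inj; rewrite /surface_pt !reprK; exact.
- exact: norm_hausdorff.
Qed.

(** ** One staircase gives one closed surface *)

Section OneStaircase.
Variables (r : nat) (x y : nat -> R).
Notation p := r.+2.
Hypothesis x_lt : forall i j, (i < j < p)%N -> x i < x j.
Hypothesis y_gt : forall i j, (i < j < p)%N -> y j < y i.
Notation stair := (stair r x y).
Hypothesis stair_allowed : forall q, stair q -> [/\ V1 q.1 <= e1, V2 q.2 <= e2 & ~ B q].
(* At a turning point the momentum vanishes, so the copies with either sign meet
   there just as they do at a wall. *)
Hypothesis stair_v : forall q, stair q -> (on_vertical B q \/ V1 q.1 = e1) <-> vwall r x y q.
Hypothesis stair_h : forall q, stair q -> (on_horizontal B q \/ V2 q.2 = e2) <-> hwall r x y q.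

Definition stair_surface : set X := surface_pt @` [set a : L | stair (val a).1].

Let c : R * R := ((x 0 + x 1) / 2, (y r.+1 + y r) / 2).

Let c_x : x 0 < c.1 < x 1.
Proof. by have := x_lt (i := 0) (j := 1) isT; rewrite /c/= => h; apply/andP; split; lra. Qed.

Let c_y : y r.+1 < c.2 < y r.
Proof.
have := y_gt (i := r) (j := r.+1); rewrite !ltnSn => /(_ isT).
by rewrite /c/= => h; apply/andP; split; lra.
Qed.

(** Extends the charts continuously from the unit square to the plane. *)
Definition clamp (t : R) : R := Num.max 0 (Num.min 1 t).

Lemma clamp01 t : 0 <= clamp t <= 1.
Proof. by rewrite /clamp le_max lexx ge_max ler01 ge_min lexx. Qed.

Lemma clampK t : 0 <= t <= 1 -> clamp t = t.
Proof. by case/andP=> t0 t1; rewrite /clamp min_r// max_r. Qed.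

Lemma clamp_continuous : continuous clamp.
Proof.
move=> t; apply: continuous_max; first exact: cvg_cst.
by apply: continuous_min; [exact: cvg_cst|exact: cvg_id].
Qed.

Definition config (d : dart p) (z : R * R) : R * R :=
  radial c (clamp z.1) (side_point x y d.1 (orient d.2 (clamp z.2))).

Lemma config_stair d z : stair (config d z).
Proof.
apply: (radial_stair x_lt y_gt c_x c_y (clamp01 _)).
by apply: (side_point_boundary x_lt y_gt _ _).1; apply/orient01/clamp01.
Qed.

Lemma config_continuous d : continuous (config d).
Proof.
have cl1 : continuous (fun z : R * R => clamp z.1).
  exact: (continuous_compose clamp_continuous (@continuous_fst _ _)).
have cl2 : continuous (fun z : R * R => clamp z.2).
  exact: (continuous_compose clamp_continuous (@continuous_snd _ _)).
have co : continuous (fun z : R * R => orient d.2 (clamp z.2)).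
  rewrite /orient; case: positive => //; apply: continuous_sub => //; exact: continuous_const.
have cs (a b : R) : continuous (fun z : R * R => a + orient d.2 (clamp z.2) * b).
  apply: continuous_add; first exact: continuous_const.
  by apply: continuous_mul => //; exact: continuous_const.
have cr (a : R) (f : R * R -> R) : continuous f -> continuous (fun z => a + clamp z.1 * (f z - a)).
  move=> cf; apply: continuous_add; first exact: continuous_const.
  by apply: continuous_mul => //; apply: continuous_sub => //; exact: continuous_const.
rewrite /config /radial /side_point; case: d.1 => i [] /=.
  apply: continuous_pair; apply: cr; [exact: continuous_const|exact: cs].
apply: continuous_pair; apply: cr; [exact: cs|exact: continuous_const].
Qed.

Definition sgn (b : bool) : R := if b then 1 else -1.

Definition momentum (V : R -> R) (e : R) (b : bool) (q : R) : R :=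
  sgn b * Num.sqrt (2 * (e - V q)).

Lemma momentum_energy V e b q : V q <= e -> energy V q (momentum V e b q) = e.
Proof.
move=> Vq; rewrite /energy /momentum exprMn sqr_sqrtr; last by rewrite mulr_ge0 ?subr_ge0.
by rewrite (_ : sgn b ^+ 2 = 1); [lra | case: b; rewrite /= ?sqrrN expr1n].
Qed.

(** On a level set, a momentum is determined by its sign and the coordinate. *)
Lemma momentum_sign V e q p0 : energy V q p0 = e -> momentum V e (0 <= p0) q = p0.
Proof.
rewrite /energy /momentum => h; have -> : 2 * (e - V q) = p0 ^+ 2 by lra.
by rewrite sqrtr_sqr; case: ger0P => _ /=; rewrite ?mul1r ?mulN1r ?opprK.
Qed.

Lemma momentum_neg V e b q : momentum V e (~~ b) q = - momentum V e b q.
Proof. by rewrite /momentum -mulNr; case: b => /=; rewrite ?opprK. Qed.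

Lemma momentum_continuous V e b : continuous V -> continuous (momentum V e b).
Proof.
move=> cV; apply: continuous_mul; first exact: continuous_const.
apply: (continuous_compose (@sqrt_continuous R)).
apply: continuous_mul; first exact: continuous_const.
by apply: continuous_sub => //; exact: continuous_const.
Qed.

Lemma momentum0 V e b q : V q <= e -> momentum V e b q = 0 <-> V q = e.
Proof.
move=> Vq; rewrite /momentum; split=> [/eqP|->]; last by rewrite subrr mulr0 sqrtr0 mulr0.
rewrite mulf_eq0 sqrtr_eq0 pmulr_rle0// subr_le0 => /orP[/eqP|eV].
  by case: b => /= h; lra.
by apply/le_anti; rewrite Vq.
Qed.

Definition phase (s : sign) (q : R * R) : (R * R) * (R * R) :=
  (q, (momentum V1 e1 s.1 q.1, momentum V2 e2 s.2 q.2)).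

Lemma phase_level s q : stair q -> phase s q \in L.
Proof.
by move=> /stair_allowed[? ? ?]; rewrite inE; split=> //=; apply: momentum_energy.
Qed.

Definition phase_lift (d : dart p) z : L :=
  exist _ (phase d.2 (config d z)) (phase_level d.2 (config_stair d z)).

Definition chart (d : dart p) z : X := surface_pt (phase_lift d z).

Lemma chart_continuous d : continuous (chart d).
Proof.
apply: (continuous_compose surface_pt_continuous).
apply: (@continuous_comp_initial _ _ _ (set_val : L -> _)).
have cc := @config_continuous d.
apply: (continuous_compose (h := phase d.2) _ cc).
apply: continuous_pair; first by move=> q; exact: cvg_id.
apply: continuous_pair.
  apply: (@continuous_compose _ _ _ (momentum V1 e1 d.2.1) fst).
    exact: (momentum_continuous cV1).
  exact: continuous_fst.
apply: (@continuous_compose _ _ _ (momentum V2 e2 d.2.2) snd).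
  exact: (momentum_continuous cV2).
exact: continuous_snd.
Qed.

Lemma chart_eqP d z d' z' (q := config d z) :
  chart d z = chart d' z' <->
  [/\ q = config d' z', d.2.1 = d'.2.1 \/ vwall r x y q & d.2.2 = d'.2.2 \/ hwall r x y q].
Proof.
have qS : stair q := config_stair d z; have [Vq1 Vq2 _] := stair_allowed qS.
rewrite /chart surface_pt_eq; change (reflected B (phase d.2 q) (phase d'.2 (config d' z')) <->
  [/\ q = config d' z', d.2.1 = d'.2.1 \/ vwall r x y q & d.2.2 = d'.2.2 \/ hwall r x y q]).
move: (config d' z') => q'; clearbody q; rewrite /reflected /=; split=> -[eq h1 h2].
- split=> //.
    have [->|n1] := eqVneq d.2.1 d'.2.1; [by left|right].
    apply/stair_v => //; case: h1 => [h1|[ov _]]; [right|by left].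
    apply/(momentum0 d.2.1 Vq1); move: h1; rewrite -eq.
    have -> : d'.2.1 = ~~ d.2.1 by move: n1; case: d.2.1 d'.2.1 => [] [].
    by rewrite momentum_neg => h; lra.
  have [->|n2] := eqVneq d.2.2 d'.2.2; [by left|right].
  apply/stair_h => //; case: h2 => [h2|[ov _]]; [right|by left].
  apply/(momentum0 d.2.2 Vq2); move: h2; rewrite -eq.
  have -> : d'.2.2 = ~~ d.2.2 by move: n2; case: d.2.2 d'.2.2 => [] [].
  by rewrite momentum_neg => h; lra.
- rewrite -eq; split=> //.
    have [->|n1] := eqVneq d.2.1 d'.2.1; first by left.
    have -> : d'.2.1 = ~~ d.2.1 by move: n1; case: d.2.1 d'.2.1 => [] [].
    rewrite momentum_neg.
    case: h1 => [e|/(stair_v qS)[ov|Ve]]; [by rewrite e eqxx in n1|by right|left].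
    by have /(momentum0 d.2.1 Vq1) -> := Ve; rewrite oppr0.
  have [->|n2] := eqVneq d.2.2 d'.2.2; first by left.
  have -> : d'.2.2 = ~~ d.2.2 by move: n2; case: d.2.2 d'.2.2 => [] [].
  rewrite momentum_neg.
  case: h2 => [e|/(stair_h qS)[ov|Ve]]; [by rewrite e eqxx in n2|by right|left].
  by have /(momentum0 d.2.2 Vq2) -> := Ve; rewrite oppr0.
Qed.

Lemma unit_square_bounds (z : R * R) : unit_square z -> 0 <= z.1 <= 1 /\ 0 <= z.2 <= 1.
Proof. by move=> [] /=; rewrite !in_itv/=. Qed.

Lemma chart_glue d z d' z' : unit_square z -> unit_square z' ->
  chart d z = chart d' z' <->
  clos_refl_sym_trans _ (side_gluing (face p) (edge p)) (d, z) (d', z').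
Proof.
case: d d' z z' => k s [k' s'] [t v] [t' v'].
move=> /unit_square_bounds/=[t01 v01] /unit_square_bounds/=[t'01 v'01].
split.
  move=> /chart_eqP[]; rewrite /config/= !clampK// => e h1 h2.
  have := glue_complete x_lt y_gt c_x c_y t01 t'01 (orient01 s v01) (orient01 s' v'01) e h1 h2.
  by rewrite /chart_point !orientK.
suff glue_chart u u' : clos_refl_sym_trans _ (side_gluing (face p) (edge p)) u u' ->
    chart u.1 u.2 = chart u'.1 u'.2 by apply: glue_chart.
have zero01 : 0 <= (0 : R) <= 1 by rewrite lexx ler01.
have one01 : 0 <= (1 : R) <= 1 by rewrite lexx ler01.
elim=> {u u'} [u u'|//|u u' _ ->//|u u' u'' _ -> _ ->//].
case=> {u u'} [d a b|d a|d a] /unit_square_bounds[/= a01 a2].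
- move=> /unit_square_bounds[/= _ b01]; apply/chart_eqP; split; [|by left|by left].
  by rewrite /config/= clampK// /radial !mul0r.
- rewrite faceE; apply/chart_eqP; split; [|by left|by left].
  rewrite /config/= !clampK// /orient; case: (boolP (positive d.2)) => ps.
    by rewrite side_point_next.
  by rewrite subrr subr0 -{1}(prev_sideK d.1) side_point_next.
- move: a2 => {}a01; have o01 := orient01 d.2 a01.
  have oE : orient (edge p d).2 (1 - a) = orient d.2 a.
    by rewrite edgeE /= /orient positive_flip; case: positive => //=; ring.
  have qw := (@side_point_wall _ _ _ _ x_lt y_gt d.1.1 d.1.2 _ o01).2.
  have a'01 : 0 <= 1 - a <= 1 by case/andP: a01 => h1 h2; apply/andP; split; lra.
  apply/chart_eqP; rewrite /config/= !clampK// oE edgeE radial1 -surjective_pairing in qw *.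
  by rewrite /edge_fun /flip; case: d.1.2 qw => /= qw; split=> //; [right|left|left|right].
Qed.

Lemma stair_surfaceE : \bigcup_d (chart d @` @unit_square R) = stair_surface.
Proof.
apply/seteqP; split=> [_ [d _ [z _ <-]]|_ [a /= aS <-]].
  by exists (phase_lift d z) => //=; exact: config_stair.
have [e1a e2a _] := level_valP a.
pose s : sign := (0 <= (val a).2.1, 0 <= (val a).2.2).
have phase_lift_a d z : d.2 = s -> config d z = (val a).1 -> chart d z = surface_pt a.
  move=> ds dq; congr surface_pt; apply: val_inj; rewrite /= ds dq /phase /= !momentum_sign//.
  by case: (val a) => q [p1 p2].
have zero01 : 0 <= (0 : R) <= 1 by rewrite lexx ler01.
have [qc|/eqP qc] := eqVneq (val a).1 c.
  exists ((ord0, false), s) => //; exists (0, 0); first exact: in_unit_square.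
  apply: phase_lift_a => //.
  by rewrite /config/= clampK// /radial !mul0r !addr0 qc -surjective_pairing.
have [t /andP[t0 t1] [k [u u01 e]]] := radial_surj x_lt y_gt c_x c_y aS qc.
have t01 : 0 <= t <= 1 by rewrite ltW.
exists (k, s) => //; exists (t, orient s u); first exact/in_unit_square/orient01.
by apply: phase_lift_a => //; rewrite /config/= !clampK ?orient01// orientK.
Qed.

(** Each copy is the union of the rays from its centre, and all four contain the
    corner (x 0, y 0). *)
Lemma stair_surface_connected : connected stair_surface.
Proof.
pose ray (s : sign) (ku : side p * R) := (fun t => chart (ku.1, s) (t, orient s ku.2)) @` `[0, 1].
pose sheet s := \bigcup_(ku in [set ku | 0 <= ku.2 <= 1]) ray s ku.
have zero01 : 0 <= (0 : R) <= 1 by rewrite lexx ler01.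
have one01 : 0 <= (1 : R) <= 1 by rewrite lexx ler01.
have sheet_connected s : connected (sheet s).
  apply: bigcup_connected.
    exists (chart ((ord0, false), s) (0, 0)) => -[k u] /= u01.
    exists 0; first by rewrite /= in_itv/= lexx ler01.
    by apply/chart_eqP; split; [|by left|by left]; rewrite /config/= clampK// /radial !mul0r.
  move=> [k u] _; apply: connected_continuous_connected; first exact: segment_connected.
  apply: continuous_subspaceT => t.
  apply: (@continuous_compose _ _ _ (chart (k, s)) (fun t => (t, orient s u))) t.
    exact: chart_continuous.
  by apply: continuous_pair; [move=> ?; exact: cvg_id|exact: continuous_const].
have -> : stair_surface = \bigcup_s sheet s.
  rewrite -stair_surfaceE; apply/seteqP; split.
    move=> _ [[k s] _ [[t v] /unit_square_bounds/=[t01 v01] <-]]; exists s => //.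
    by exists (k, orient s v) => /=; [exact: orient01 | exists t; rewrite ?orientK//= in_itv].
  move=> _ [s _ [[k u] /= u01 [t /= t01 <-]]]; exists (k, s) => //.
  by exists (t, orient s u) => //; apply: in_unit_square; rewrite ?orient01.
apply: bigcup_connected => //.
exists (chart ((ord0, false), (true, true)) (1, 0)) => s _.
exists ((ord0, false), 0) => //=; exists 1; first by rewrite /= in_itv/= lexx ler01.
have cornerE : config ((ord0, false), s) (1, orient s 0) = (x 0, y 0).
  by rewrite /config/= !clampK ?orient01// orientK radial1 /side_point/= mul0r addr0.
apply/chart_eqP; rewrite cornerE; split; last 2 first.
- by right; left.
- by right; right; exists ord0.
by rewrite /config/= !clampK// radial1 /side_point/= mul0r addr0.
Qed.

(** With [p = r.+2], there are [2 p] vertices, [4 p] edges and [4] faces. *)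
Lemma stair_surface_genus : hausdorff_space X -> has_genus R stair_surface r.+1.
Proof.
move=> hX; split=> //; first exact: stair_surface_connected.
exists (dart p), (face p), (edge p), chart; split; last first.
  by rewrite card_vertices card_faces// card_edges; lia.
split.
- exact: edge_involution.
- by move=> d; apply: continuous_subspaceT => z; apply: chart_continuous.
- exact: stair_surfaceE.
- by move=> d z d' z'; apply: chart_glue.
Qed.

End OneStaircase.
End LevelSurface.

(** ** Disjoint staircases give the components *)

(** Finitely many disjoint closed pieces that cover the space are also open, so
    the connected ones are the components. *)
Lemma has_genera_of_pieces (R : realType) (X : topologicalType) (gs : seq nat)
    (C : 'I_(size gs) -> set X) :
    (forall i, closed (C i)) -> (forall i, C i !=set0) -> trivIset setT C ->
    \bigcup_i C i = setT -> (forall i, has_genus R (C i) (nth 0%N gs i)) ->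
  has_genera R X gs.
Proof.
move=> C_closed C_neq0 C_triv C_cover C_genus.
have C_inj : injective C.
  move=> i j eij; have [a Ca] := C_neq0 i.
  by apply: (C_triv i j) => //; exists a; rewrite -eij.
have C_open i : open (C i).
  have -> : C i = ~` \bigcup_(j in [set j | j != i]) C j.
    apply/seteqP; split=> [a Ca [j /= ji Cj]|a aN].
      by move/eqP: ji; apply; apply: (C_triv j i) => //; exists a.
    have [j _ Cj] : (\bigcup_i C i) a by rewrite C_cover.
    by have [<-//|ji] := eqVneq j i; case: aN; exists j.
  apply/closed_openC/closed_bigcup => [|j _]; [exact: finite_finset|exact: C_closed].
have componentE i a : C i a -> connected_component setT a = C i.
  move=> Ca; apply/seteqP; split; last first.
    by apply: connected_component_max => //; have [] := C_genus i.
  have K_connected := @component_connected _ setT a.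
  have -> : connected_component setT a = connected_component setT a `&` C i.
    apply/esym/K_connected.
    - by exists a; split=> //; apply: connected_component_refl.
    - by exists (C i).
    - by exists (C i).
  by move=> b [].
exists C; split=> //; apply/seteqP; split=> [_ [i _ <-]|_ [a _ <-]].
  by have [a Ca] := C_neq0 i; exists a => //; exact: componentE.
have [i _ Ca] : (\bigcup_i C i) a by rewrite C_cover.
by exists i => //; rewrite (componentE i).
Qed.

Lemma continuous_prod (R : realType) (T : topologicalType) (I : Type) (s : seq I)
    (F : I -> T -> R) :
  (forall i, continuous (F i)) -> continuous (fun q => \prod_(i <- s) F i q).
Proof.
move=> cF; elim: s => [|i s IH].
  by under eq_fun do rewrite big_nil; exact: continuous_const.
by under eq_fun do rewrite big_cons; exact: continuous_mul.
Qed.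

Section WallDistance.
Variable R : realType.
Implicit Types a b v : R.

(** The triangle inequality makes this vanish exactly between [a] and [b]. *)
Definition detour a b v : R := `|v - a| + `|v - b| - `|b - a|.

Lemma detour0 a b v : detour a b v = 0 -> exists2 t, 0 <= t <= 1 & v = a + t * (b - a).
Proof.
move=> d0; have [ab|ba|eab] := ltgtP a b.
- apply: segment_param => //; move: d0; rewrite /detour.
  by case: (ger0P (v - a)); case: (ger0P (v - b)); case: (ger0P (b - a)) => *;
    apply/andP; split; lra.
- apply: segment_param_rev => //; move: d0; rewrite /detour.
  by case: (ger0P (v - a)); case: (ger0P (v - b)); case: (ger0P (b - a)) => *;
    apply/andP; split; lra.
- exists 0; rewrite ?lexx ?ler01// mul0r addr0; move: d0; rewrite eab /detour subrr normr0 subr0.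
  by case: (ger0P (v - b)) => *; lra.
Qed.

Lemma detour_segment a b t : 0 <= t <= 1 -> detour a b (a + t * (b - a)) = 0.
Proof.
case/andP=> t0 t1; rewrite /detour [a + _]addrC addrK.
have -> : t * (b - a) + a - b = - ((1 - t) * (b - a)) by ring.
by rewrite normrN !normrM (ger0_norm t0) (@ger0_norm _ (1 - t)) ?subr_ge0//; ring.
Qed.

Lemma detour_ge0 a b v : 0 <= detour a b v.
Proof. by rewrite /detour subr_ge0 (addrC `|v - a|) (distrC v b) ler_distD. Qed.

Lemma detour_continuous a b : continuous (detour a b).
Proof.
have cn d : continuous (fun v : R => `|v - d|).
  apply: (continuous_compose (@norm_continuous _ R)).
  by apply: continuous_sub; [move=> ?; exact: cvg_id|exact: continuous_const].
by apply: continuous_sub; [exact: continuous_add|exact: continuous_const].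
Qed.

Variables (r : nat) (x y : nat -> R).

Definition side_dist (k : side r.+2) (q : R * R) : R :=
  if k.2 then `|q.1 - x (ordS k.1)| + detour (y k.1) (y (ordS k.1)) q.2
  else `|q.2 - y k.1| + detour (x k.1) (x (ordS k.1)) q.1.

Lemma side_dist0 k q : side_dist k q = 0 <-> exists2 t, 0 <= t <= 1 & q = side_point x y k t.
Proof.
case: k q => i b [u v]; rewrite /side_dist/side_point/=; split.
  case: b => /eqP; rewrite paddr_eq0 ?normr_ge0 ?detour_ge0// normr_eq0 subr_eq0;
    by move=> /andP[/eqP -> /eqP/detour0[t t01 ->]]; exists t.
by move=> [t t01]; case: b => -[-> ->]; rewrite subrr normr0 add0r detour_segment.
Qed.

Lemma side_dist_continuous k : continuous (side_dist k).
Proof.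
have cn (T : topologicalType) (f : T -> R) (d : R) :
    continuous f -> continuous (fun z : T => `|f z - d|).
  move=> cf; apply: (continuous_compose (@norm_continuous _ R)).
  by apply: continuous_sub => //; exact: continuous_const.
rewrite /side_dist; case: k.2; apply: continuous_add.
- exact: (cn _ _ _ (@continuous_fst R R)).
- exact: (continuous_compose (@detour_continuous _ _) (@continuous_snd R R)).
- exact: (cn _ _ _ (@continuous_snd R R)).
- exact: (continuous_compose (@detour_continuous _ _) (@continuous_fst R R)).
Qed.

End WallDistance.

Lemma energy_potential (R : realType) (V : R -> R) e q p : energy V q p = e -> V q <= e.
Proof. by move=> <-; rewrite /energy lerDr divr_ge0 ?sqr_ge0. Qed.

Section Components.
Variables (R : realType) (V1 V2 : R -> R) (B : set (R * R)) (e1 e2 : R).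
Hypotheses (cV1 : continuous V1) (cV2 : continuous V2).
Notation X := (level_surface V1 V2 B e1 e2).

(** The sides of the staircase are the places where the level set meets a wall or
    a turning line. *)
Record billiard_stair (r : nat) (x y : nat -> R) : Prop := BilliardStair {
  billiard_x : forall i j, (i < j < r.+2)%N -> x i < x j;
  billiard_y : forall i j, (i < j < r.+2)%N -> y j < y i;
  billiard_allowed : forall q, stair r x y q -> [/\ V1 q.1 <= e1, V2 q.2 <= e2 & ~ B q];
  billiard_v : forall q, stair r x y q ->
    (on_vertical B q \/ V1 q.1 = e1) <-> vwall r x y q;
  billiard_h : forall q, stair r x y q ->
    (on_horizontal B q \/ V2 q.2 = e2) <-> hwall r x y q }.

Variables (n : nat) (r : nat -> nat) (x y : nat -> nat -> R).
Hypothesis stairs : forall j, (j < n)%N -> billiard_stair (r j) (x j) (y j).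
Hypothesis stairs_cover : forall q, V1 q.1 <= e1 -> V2 q.2 <= e2 -> ~ B q ->
  exists2 j, (j < n)%N & stair (r j) (x j) (y j) q.
Hypothesis stairs_disjoint : forall q j j', (j < n)%N -> (j' < n)%N ->
  stair (r j) (x j) (y j) q -> stair (r j') (x j') (y j') q -> j = j'.

Let level_stair (a : level_set V1 V2 B e1 e2) :
  exists2 j, (j < n)%N & stair (r j) (x j) (y j) (val a).1.
Proof.
have [h1 h2 nB] := level_valP a; apply: stairs_cover => //.
- exact: energy_potential h1.
- exact: energy_potential h2.
Qed.

(** The product of the distances to all vertical (horizontal) sides vanishes
    exactly on the vertical (horizontal) walls. Distances to the lines that
    carry the sides would not do, as these lines may cross other staircases. *)
Lemma stairs_hausdorff : hausdorff_space X.
Proof.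
pose wall_dist b q := \prod_(j < n) \prod_(i < (r j).+2) side_dist (x j) (y j) (i, b) q.
have wall_dist_continuous b : continuous (wall_dist b).
  by apply: continuous_prod => j; apply: continuous_prod => i; apply: side_dist_continuous.
have wall_dist0 b q j : (j < n)%N -> stair (r j) (x j) (y j) q ->
    wall_dist b q = 0 <-> 
      (if b then vwall (r j) (x j) (y j) else hwall (r j) (x j) (y j)) q.
  move=> jn jq; split.
    move=> /eqP/prodf_eq0[j' _ /prodf_eq0[i _ /eqP/side_dist0[t t01 e]]].
    have [jx jy _ _ _] := stairs (ltn_ord j').
    have [sq wq] := side_point_wall jx jy i b t01.
    rewrite -e in sq wq.
    by have <- := stairs_disjoint (ltn_ord j') jn sq jq.
  have [jx jy _ _ _] := stairs jn.
  move=> /(wall_side_point jx jy jq)[i e]; apply/eqP.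
  apply/prodf_eq0; exists (Ordinal jn) => //; apply/prodf_eq0; exists i => //.
  by apply/eqP/side_dist0.
apply: (@level_surface_hausdorff _ V1 V2 B e1 e2 (wall_dist true) (wall_dist false)) => // a.
- have [j jn jq] := level_stair a; move=> ov; apply/(wall_dist0 true _ _ jn jq).
  by apply/(billiard_v (stairs jn)) => //; left.
- have [j jn jq] := level_stair a; move=> ov; apply/(wall_dist0 false _ _ jn jq).
  by apply/(billiard_h (stairs jn)) => //; left.
- have [j jn jq] := level_stair a; move=> /(wall_dist0 true _ _ jn jq).
  move=> /(billiard_v (stairs jn) jq)[|e]; [by left|right].
  have [+ _ _] := level_valP a; rewrite /energy e => h.
  by apply/eqP; rewrite -sqrf_eq0; apply/eqP; lra.
- have [j jn jq] := level_stair a; move=> /(wall_dist0 false _ _ jn jq).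
  move=> /(billiard_h (stairs jn) jq)[|e]; [by left|right].
  have [_ + _] := level_valP a; rewrite /energy e => h.
  by apply/eqP; rewrite -sqrf_eq0; apply/eqP; lra.
Qed.

Theorem level_surface_genera : has_genera R X (mkseq (fun j => (r j).+1) n).
Proof.
have hX := stairs_hausdorff.
pose C (i : 'I_(size (mkseq (fun j => (r j).+1) n))) : set X := stair_surface (r i) (x i) (y i).
have lt_n (i : 'I_(size (mkseq (fun j => (r j).+1) n))) : (i < n)%N.
  by have := ltn_ord i; rewrite [X in (_ < X)%N]size_mkseq.
apply: (@has_genera_of_pieces _ _ _ C).
- move=> i; have [jx jy ja _ _] := stairs (lt_n i).
  rewrite /C -(stair_surfaceE jx jy ja); apply: closed_bigcup => [|d _]; first exact: finite_finset.
  apply: compact_closed hX _; apply: continuous_compact.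
    by apply: continuous_subspaceT => z; apply: chart_continuous.
  by apply: compact_setX; apply: segment_compact.
- move=> i; have [jx jy ja _ _] := stairs (lt_n i).
  exists (chart jx jy ja ((ord0, false), (true, true)) (0, 0)).
  rewrite /C -(stair_surfaceE jx jy ja); exists ((ord0, false), (true, true)) => //.
  by exists (0, 0) => //; apply: in_unit_square; rewrite lexx ler01.
- move=> i j _ _ [_ [[a /= aS <-] [b /= bS /surface_pt_eq[eq _ _]]]].
  by apply/val_inj/(stairs_disjoint (lt_n i) (lt_n j) aS); rewrite -eq.
- apply/seteqP; split=> // z _; have [a ->] := surface_pt_surj z.
  have [j jn jS] := level_stair a.
  have jn' : (j < size (mkseq (fun j => (r j).+1) n))%N by rewrite size_mkseq.
  by exists (Ordinal jn') => //; exists a.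
- move=> i; have [jx jy ja jv jh] := stairs (lt_n i).
  by rewrite nth_mkseq//; apply: stair_surface_genus.
Qed.

End Components.

(** * Staircases with corners on a line, and their walls *)

Section SeqStair.
Variables (R : realType) (a b top bot k : R) (s : seq R).

(** The reflex corners are the points (z, k - z) for [z] in [s]. *)
Definition seq_x : nat -> R := nth 0 (a :: rcons s b).
Definition seq_y : nat -> R := nth 0 (top :: rcons [seq k - z | z <- s] bot).

Hypothesis s_sorted : sorted <%R (a :: rcons s b).
Hypothesis t_sorted : sorted >%R (top :: rcons [seq k - z | z <- s] bot).

Lemma seq_x_lt i j : (i < j < (size s).+2)%N -> seq_x i < seq_x j.
Proof.
move=> /andP[ij jp]; apply: (sorted_ltn_nth lt_trans) => //; rewrite inE /= size_rcons//.
exact: ltn_trans jp.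
Qed.

Lemma seq_y_gt i j : (i < j < (size s).+2)%N -> seq_y j < seq_y i.
Proof.
move=> /andP[ij jp]; have gt_trans : transitive (>%R : rel R).
  by move=> u v z vu zv; exact: lt_trans zv vu.
by apply: (sorted_ltn_nth gt_trans 0 t_sorted) (ij);
  rewrite inE /= size_rcons size_map// (ltn_trans ij).
Qed.

Lemma seq_y0 : seq_y 0 = top. Proof. by []. Qed.
Lemma seq_xS i : (i < size s)%N -> seq_x i.+1 = nth 0 s i.
Proof. by move=> h; rewrite /seq_x/= nth_rcons h. Qed.
Lemma seq_yS i : (i < size s)%N -> seq_y i.+1 = k - nth 0 s i.
Proof. by move=> h; rewrite /seq_y/= nth_rcons size_map h (nth_map 0). Qed.
Lemma seq_x_last : seq_x (size s).+1 = b.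
Proof. by rewrite /seq_x/= nth_rcons ltnn eqxx. Qed.
Lemma seq_y_last : seq_y (size s).+1 = bot.
Proof. by rewrite /seq_y/= nth_rcons size_map ltnn eqxx. Qed.

Lemma ord_split3 (i : 'I_(size s).+2) :
  [\/ i = 0 :> nat, i = (size s).+1 :> nat | exists2 l, (l < size s)%N & i = l.+1 :> nat].
Proof.
case: i => -[|i] ip; first by constructor 1.
have [ir|ir] := ltnP i (size s); first by constructor 3; exists i.
by constructor 2; apply/anti_leq; rewrite -ltnS ip /= ltnS.
Qed.

Lemma seq_stairP q : stair (size s) seq_x seq_y q <->
  [/\ a <= q.1 <= b, bot <= q.2 <= top & forall z, z \in s -> q.1 <= z \/ q.2 <= k - z].
Proof.
rewrite /stair/= seq_x_last seq_y_last; split=> -[h1 h2 h3]; split=> //.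
  move=> z /(nthP 0)[l ls <-]; have := h3 (inord l.+1).
  by rewrite inordK ?ltnS ?(ltnW ls)// seq_xS// seq_yS.
move=> i; case: (ord_split3 i) => [->|->|[l ls ->]].
- by right; rewrite seq_y0; case/andP: h2.
- by left; rewrite seq_x_last; case/andP: h1.
- by rewrite seq_xS// seq_yS//; apply/h3/mem_nth.
Qed.

Lemma seq_vwallP q : stair (size s) seq_x seq_y q -> vwall (size s) seq_x seq_y q <->
  [\/ q.1 = a, q.1 = b | exists2 z, z \in s & q.1 = z /\ k - z <= q.2].
Proof.
move=> /seq_stairP[_ /andP[h2 _] _]; split.
  move=> [/= ->|[i i0 [-> h]]]; first by constructor 1.
  move: i0 h; case: (ord_split3 i) => [->//|-> _ _|[l ls ->] _].
    by rewrite seq_x_last; constructor 2.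
  by rewrite seq_xS// seq_yS// => h; constructor 3; exists (nth 0 s l); rewrite ?mem_nth.
case=> [e|e|[z /(nthP 0)[l ls <-] [e h]]]; first by left.
  by right; exists ord_max => //=; rewrite seq_x_last seq_y_last.
right; exists (inord l.+1); rewrite inordK ?ltnS ?(ltnW ls)//.
by rewrite seq_xS// seq_yS.
Qed.

Lemma seq_hwallP q : stair (size s) seq_x seq_y q -> hwall (size s) seq_x seq_y q <->
  [\/ q.2 = bot, q.2 = top | exists2 z, z \in s & q.2 = k - z /\ z <= q.1].
Proof.
move=> /seq_stairP[/andP[h1 _] _ _]; split.
  move=> [/= ->|[i i0 [-> h]]]; first by rewrite seq_y_last; constructor 1.
  move: i0 h; case: (ord_split3 i) => [-> _ _|->|[l ls ->] _]; last 1 first.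
  - by rewrite seq_xS// seq_yS// => h; constructor 3; exists (nth 0 s l); rewrite ?mem_nth.
  - by constructor 2.
  - by rewrite ltnn.
case=> [e|e|[z /(nthP 0)[l ls <-] [e h]]]; first by left; rewrite /= seq_y_last.
  by right; exists ord0.
right; exists (inord l.+1); rewrite inordK ?ltnS ?(ltnW ls)//.
by rewrite seq_xS// seq_yS.
Qed.

End SeqStair.

Section Walls.
Variables (R : realType) (B : set (R * R)) (r : nat) (x y : nat -> R).
Hypothesis x_lt : forall i j, (i < j < r.+2)%N -> x i < x j.
Hypothesis y_gt : forall i j, (i < j < r.+2)%N -> y j < y i.
Hypothesis stair_out : forall q, stair r x y q -> ~ B q.

Lemma frontier_out q : closure B q -> ~ B q -> frontier B q.
Proof. by move=> cq nq; split=> // /interior_subset. Qed.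

(** A side of the polygon lies on a wall as soon as it lies in the closure of
    the barrier. *)
Lemma side_on_vertical q : stair r x y q -> vwall r x y q ->
  (forall z, stair r x y z -> vwall r x y z -> z.1 = q.1 -> closure B z) -> on_vertical B q.
Proof.
move=> qS qw cl; have [i [t t01 eq]] := wall_side_point (b := true) x_lt y_gt qS qw.
have onside v : (exists2 u, 0 <= u <= 1 & v = y i + u * (y (ordS i) - y i)) -> frontier B (q.1, v).
  move=> [u u01 ->]; have [sS sw] := side_point_wall x_lt y_gt i true u01.
  by rewrite eq; apply: frontier_out; [apply: cl; rewrite // eq|exact: stair_out].
have [lt|gt] := ltP (y i) (y (ordS i)).
  exists (y i), (y (ordS i)); split=> //.
    by rewrite eq side_point_v/=; have [] := segment_bounds (ltW lt) t01.
  by move=> v /(segment_param lt); exact: onside.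
have {}gt : y (ordS i) < y i.
  by rewrite lt_neqAle gt andbT -subr_eq0 y_ordS_neq.
exists (y (ordS i)), (y i); split=> //.
  by rewrite eq side_point_v/=; have [] := segment_bounds (ltW gt) t01.
by move=> v /(segment_param_rev gt); exact: onside.
Qed.

Lemma side_on_horizontal q : stair r x y q -> hwall r x y q ->
  (forall z, stair r x y z -> hwall r x y z -> z.2 = q.2 -> closure B z) -> on_horizontal B q.
Proof.
move=> qS qw cl; have [i [t t01 eq]] := wall_side_point (b := false) x_lt y_gt qS qw.
have onside v : (exists2 u, 0 <= u <= 1 & v = x i + u * (x (ordS i) - x i)) -> frontier B (v, q.2).
  move=> [u u01 ->]; have [sS sw] := side_point_wall x_lt y_gt i false u01.
  by rewrite eq; apply: frontier_out; [apply: cl; rewrite // eq|exact: stair_out].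
have [lt|gt] := ltP (x i) (x (ordS i)).
  exists (x i), (x (ordS i)); split=> //.
    by rewrite eq side_point_h/=; have [] := segment_bounds (ltW lt) t01.
  by move=> v /(segment_param lt); exact: onside.
have {}gt : x (ordS i) < x i.
  by rewrite lt_neqAle gt andbT -subr_eq0 x_ordS_neq.
exists (x (ordS i)), (x i); split=> //.
  by rewrite eq side_point_h/=; have [] := segment_bounds (ltW gt) t01.
by move=> v /(segment_param_rev gt); exact: onside.
Qed.

Lemma closure_direction q (d1 d2 : R) :
  (\forall t \near (0 : R)^'+, B (q.1 + t * d1, q.2 + t * d2)) -> closure B q.
Proof.
move=> nB U Uq.
have ct : (fun t => (q.1 + t * d1, q.2 + t * d2)) t @[t --> (0 : R)^'+] --> q.
  apply: cvg_at_right_filter.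
  rewrite [X in _ --> X](_ : q = (q.1 + 0 * d1, q.2 + 0 * d2)); last first.
    by rewrite !mul0r !addr0 -surjective_pairing.
  have cd (a d : R) : continuous (fun t : R => a + t * d).
    apply: continuous_add; first exact: continuous_const.
    by apply: continuous_mul; [move=> ?; exact: cvg_id|exact: continuous_const].
  exact: (continuous_pair (cd _ _) (cd _ _)).
have [t [Bt Ut]] := filter_ex (filterI nB (ct _ Uq)).
by exists (q.1 + t * d1, q.2 + t * d2).
Qed.

End Walls.

(** Applied to a frontier segment through [u], this yields a frontier point at
    which no bound from [s] is attained and which satisfies strictly all those
    that [u] satisfies strictly. *)
Lemma near_generic (R : realType) (s : seq R) (a b u : R) : a < b -> a <= u <= b ->
  exists v, [/\ a <= v <= b, v \notin s &
    forall z, z \in s -> (z < u -> z < v) /\ (u < z -> v < z)].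
Proof.
move=> ab /andP[au ub].
have [d d0 d_sep] : exists2 d, 0 < d & forall z, z \in s -> z != u -> d <= `|z - u|.
  elim: s => [|z s' [d d0 IH]]; first by exists 1.
  exists (if z == u then d else Num.min d `|z - u|).
    by case: eqVneq => // zu; rewrite lt_min d0 normr_gt0 subr_eq0.
  move=> z'; rewrite inE => /predU1P[->|z's] zu.
    by rewrite (negPf zu) ge_min lexx orbT.
  by case: eqVneq => _; rewrite ?ge_min IH.
have [v [vab vu vd]] : exists v, [/\ a <= v <= b, v != u & `|v - u| < d].
  have [ub'|bu] := ltP u b.
    exists (u + Num.min d (b - u) / 2).
    have m0 : 0 < Num.min d (b - u) by rewrite lt_min d0 subr_gt0.
    have md : Num.min d (b - u) <= d by rewrite ge_min lexx.
    have mb : Num.min d (b - u) <= b - u by rewrite ge_min lexx orbT.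
    split; first by apply/andP; split; lra.
      by rewrite gt_eqF//; lra.
    by rewrite addrC addKr gtr0_norm; lra.
  have au' : a < u by exact: lt_le_trans bu.
  exists (u - Num.min d (u - a) / 2).
  have m0 : 0 < Num.min d (u - a) by rewrite lt_min d0 subr_gt0.
  have md : Num.min d (u - a) <= d by rewrite ge_min lexx.
  have mb : Num.min d (u - a) <= u - a by rewrite ge_min lexx orbT.
  split; first by apply/andP; split; lra.
    by rewrite lt_eqF//; lra.
  by rewrite addrC addKr normrN gtr0_norm; lra.
exists v; split=> //; first by apply/negP => /d_sep /(_ vu); rewrite leNgt vd.
move=> z /d_sep zd; move: vd; rewrite ltr_norml => /andP[h1 h2]; split=> zu.
  by move: (zd (negbT (lt_eqF zu))); rewrite ltr0_norm ?subr_lt0//; lra.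
by move: (zd (negbT (gt_eqF zu))); rewrite gtr0_norm ?subr_gt0//; lra.
Qed.

(** * The table *)

Section Covered.
Variables (T : Type) (q : T).

Definition covered (bs : seq (set T)) : Prop := foldr (fun b P => b q \/ P) False bs.

Lemma covered_nth bs : covered bs <-> exists2 i, (i < size bs)%N & nth set0 bs i q.
Proof.
elim: bs => [|b bs IH]; first by split=> // -[].
split=> [[bq|/IH[i ilt iq]]|[[|i] ilt iq]]; first by exists 0%N.
- by exists i.+1.
- by left.
- by right; apply/IH; exists i.
Qed.

Lemma covered_cat bs bs' : covered (bs ++ bs') <-> covered bs \/ covered bs'.
Proof. by elim: bs => [|b bs IH] /=; [tauto|rewrite IH; tauto]. Qed.

Lemma covered_map (I : eqType) (F : I -> set T) (s : seq I) :
  covered [seq F z | z <- s] <-> exists2 z, z \in s & F z q.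
Proof.
elim: s => [|z s IH] /=; first by split=> // -[].
rewrite IH; split=> [[Fz|[z' z's Fz']]|[z' + Fz']].
- by exists z; rewrite ?mem_head.
- by exists z'; rewrite // in_cons z's orbT.
- by rewrite in_cons => /predU1P[<-|z's]; [left|right; exists z'].
Qed.

End Covered.

Section Table.
Variables (R : realType) (m k : R) (xs : seq R) (N : nat) (A D : nat -> R) (w : R * R).

Implicit Types q : R * R.

(** The first three steps, together, cover the half-planes to the left of [m] and
    below [m]. *)
Definition table_barriers : seq (set (R * R)) :=
  [:: step true true (m, m); step true false (m, m - 1); step false true (m - 1, m)] ++
  [seq step false false (z, k - z) | z <- xs] ++
  [seq `]D j, A j.+1[ `*` setT | j <- iota 0 N.-1].

Lemma table_barriers_barrier (D_lt_A : forall j, D j < A j.+1) i :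
  (i < size table_barriers)%N -> barrier (nth set0 table_barriers i).
Proof.
rewrite /table_barriers; case: i => [|[|[|i]]]; do ?by move=> _; exact: barrier_step.
rewrite size_cat /= !addSn !ltnS => ilt; rewrite nth_cat size_map.
have [h|h] := ltnP i (size xs); first by rewrite (nth_map 0)//; exact: barrier_step.
move: ilt; rewrite size_cat !size_map size_iota => ilt.
by rewrite (nth_map 0%N) ?size_iota; [exact: barrier_vstrip|lia].
Qed.

Hypothesis w_le : w.1 <= m /\ w.2 <= m.

Definition table : set (R * R) :=
  step true true w `|` \bigcup_(i < size table_barriers) nth set0 table_barriers i.

Definition allowed q : Prop :=
  [/\ m <= q.1, m <= q.2, forall z, z \in xs -> q.1 <= z \/ q.2 <= k - z &
      forall j, (j.+1 < N)%N -> q.1 <= D j \/ A j.+1 <= q.1].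

Lemma tableP q : table q <-> [\/ q.1 < m, q.2 < m, exists2 z, z \in xs & z < q.1 /\ k - z < q.2 |
  exists2 j, (j.+1 < N)%N & D j < q.1 < A j.+1].
Proof.
have -> : table q <-> step true true w q \/ covered q table_barriers.
  rewrite covered_nth; split=> -[h|[i ilt iq]]; [by left| |by left|];
    by right; exists i.
rewrite /table_barriers !covered_cat !covered_map; split.
  case=> [[/= h _]|[[|[|[|[]]]]|[[z zs]|[j js]]]].
  - by constructor 1; apply: lt_le_trans h w_le.1.
  - by move=> [/= h _]; constructor 1.
  - by move=> [/= h _]; constructor 1.
  - by move=> [/= _ h]; constructor 2.
  - by move=> [/= h1 h2]; constructor 3; exists z.
  - move=> [/= h _]; constructor 4; exists j; last by rewrite in_itv/= in h.
    by move: js; rewrite mem_iota; lia.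
move=> h; right; move: h => [h|h|[z zs [h1 h2]]|[j jN h]].
- left; have [h2|h2] := ltP q.2 m; first by left.
  by right; left; split=> //=; lra.
- left; have [h2|h2] := ltP q.1 m; first by left.
  by right; right; left; split=> //=; lra.
- by right; left; exists z.
- by right; right; exists j; [rewrite mem_iota; lia|split=> //=; rewrite in_itv].
Qed.

Lemma table_out q : ~ table q <-> allowed q.
Proof.
rewrite tableP; split=> [h|[h1 h2 h3 h4]].
  split.
  - by rewrite leNgt; apply/negP => h'; apply: h; constructor 1.
  - by rewrite leNgt; apply/negP => h'; apply: h; constructor 2.
  - move=> z zs; have [|h1] := leP q.1 z; [by left|right].
    by rewrite leNgt; apply/negP => h2; apply: h; constructor 3; exists z.
  - move=> j jN; have [|h1] := leP q.1 (D j); [by left|right].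
    by rewrite leNgt; apply/negP => h2; apply: h; constructor 4; exists j; rewrite ?h1.
case=> [|||]; rewrite ?ltNge ?h1 ?h2//.
  by move=> [z zs [q1 q2]]; case: (h3 z zs); rewrite leNgt ?q1 ?q2.
by move=> [j jN /andP[q1 q2]]; case: (h4 j jN); rewrite leNgt ?q1 ?q2.
Qed.

Let cfst : continuous (fst : R * R -> R) := @continuous_fst R R.
Let csnd : continuous (snd : R * R -> R) := @continuous_snd R R.

Lemma table_open : open table.
Proof.
have /continuousP ofst := cfst; have /continuousP osnd := csnd.
have -> : table = (fst @^-1` [set u | u < m]) `|` (snd @^-1` [set v | v < m]) `|`
    (\bigcup_(z in [set` xs]) ((fst @^-1` [set u | z < u]) `&` (snd @^-1` [set v | k - z < v]))) `|`
    (\bigcup_(j in [set j | (j.+1 < N)%N]) (fst @^-1` `]D j, A j.+1[)).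
  apply/seteqP; split=> q; rewrite tableP /=.
    move=> [h|h|[z zs [h1 h2]]|[j jN h]].
    - by left; left; left.
    - by left; left; right.
    - by left; right; exists z.
    - by right; exists j => //=; rewrite in_itv.
  move=> [[[h|h]|[z zs [h1 h2]]]|[j jN h]].
  - by constructor 1.
  - by constructor 2.
  - by constructor 3; exists z.
  - by constructor 4; exists j => //; rewrite /= in_itv in h.
apply: openU; [apply: openU; [apply: openU|]|].
- by apply: ofst; exact: open_lt.
- by apply: osnd; exact: open_lt.
- apply: bigcup_open => z _; apply: openI; first by apply: ofst; exact: open_gt.
  by apply: osnd; exact: open_gt.
- by apply: bigcup_open => j _; apply: ofst; exact: interval_open.
Qed.

(** The barrier is contained in the closed set given by the weak inequalities. *)
Lemma closure_table q : closure table q ->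
  [\/ q.1 <= m, q.2 <= m, exists2 z, z \in xs & z <= q.1 /\ k - z <= q.2 |
  exists2 j, (j.+1 < N)%N & D j <= q.1 <= A j.+1].
Proof.
have /continuous_closedP lfst := cfst; have /continuous_closedP lsnd := csnd.
pose K := (fst @^-1` [set u | u <= m]) `|` (snd @^-1` [set v | v <= m]) `|`
    (\bigcup_(z in [set` xs])
      ((fst @^-1` [set u | z <= u]) `&` (snd @^-1` [set v | k - z <= v]))) `|`
    (\bigcup_(j in [set j | (j.+1 < N)%N]) (fst @^-1` `[D j, A j.+1])).
have K_closed : closed K.
  apply: closedU; [apply: closedU; [apply: closedU|]|].
  - by apply: lfst; exact: closed_le.
  - by apply: lsnd; exact: closed_le.
  - apply: closed_bigcup => [|z _]; first exact: finite_seq.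
    by apply: closedI; [by apply: lfst; exact: closed_ge|by apply: lsnd; exact: closed_ge].
  - apply: closed_bigcup => [|j _]; last by apply: lfst; exact: interval_closed.
    by apply: sub_finite_set (finite_II N) => j /= /ltnW.
have table_K : table `<=` K.
  move=> z; rewrite tableP /K /= => -[h|h|[c cs [h1 h2]]|[j jN /andP[h1 h2]]].
  - by left; left; left; exact: ltW.
  - by left; left; right; exact: ltW.
  - by left; right; exists c => //; split; exact: ltW.
  - by right; exists j => //=; rewrite in_itv/= !ltW.
move=> /(closureS table_K); rewrite -(closure_id K).1//.
move=> [[[h|h]|[z zs [h1 h2]]]|[j jN h]].
- by constructor 1.
- by constructor 2.
- by constructor 3; exists z.
- by constructor 4; exists j => //; rewrite /= in_itv in h.
Qed.

Lemma frontier_allowed q : frontier table q -> allowed q /\ closure table q.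
Proof.
by move=> [cq nq]; split=> //; apply/table_out => tq; apply: nq; have /interior_id -> := table_open.
Qed.

(** A frontier segment through [q] would contain a point whose height attains no
    bound. Some bound is attained there, so it is one on the common abscissa,
    and is attained at [q] as well. *)
Lemma not_on_vertical q : m < q.1 -> (forall z, z \in xs -> q.1 != z \/ q.2 < k - z) ->
    (forall j, (j.+1 < N)%N -> q.1 < D j \/ A j.+1 < q.1) ->
  ~ on_vertical table q.
Proof.
move=> qm qxs qgap [a [b [ab qab fr]]].
have [v [vab vgen vside]] := near_generic (m :: [seq k - z | z <- xs]) ab qab.
have [[h1 h2 h3 h4] /closure_table] := frontier_allowed (fr v vab).
case=> /= [h|h|[z zs [zq zv]]|[j jN /andP[Dq qA]]].
- by rewrite leNgt qm in h.
- by move/negP: vgen; apply; rewrite in_cons (_ : v = m) ?eqxx//; apply/le_anti; rewrite h h2.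
- have zin : k - z \in m :: [seq k - z | z <- xs].
    by rewrite in_cons (map_f (fun z => k - z) zs) orbT.
  have {}zv : k - z < v.
    rewrite lt_neqAle zv andbT; apply/eqP => e.
    by move/negP: vgen; apply; rewrite -e.
  have eqz : q.1 = z.
    by apply/le_anti; rewrite zq andbT; case: (h3 z zs) => //=; rewrite leNgt zv.
  case: (qxs z zs); first by rewrite eqz eqxx.
  by move=> /(vside _ zin).2; rewrite ltNge (ltW zv).
- by case: (qgap j jN); rewrite ltNge ?Dq ?qA.
Qed.

(** The same argument with a generic abscissa. *)
Lemma not_on_horizontal q : m < q.2 -> (forall z, z \in xs -> q.2 != k - z \/ q.1 < z) ->
  ~ on_horizontal table q.
Proof.
move=> qm qxs [a [b [ab qab fr]]].
pose s := m :: xs ++ map D (iota 0 N) ++ map A (iota 0 N).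
have [u [uab ugen uside]] := near_generic s ab qab.
have [[h1 h2 h3 h4] /closure_table] := frontier_allowed (fr u uab).
case=> /= [h|h|[z zs [zq zv]]|[j jN /andP[Dq qA]]].
- by move/negP: ugen; apply; rewrite in_cons (_ : u = m) ?eqxx//; apply/le_anti; rewrite h h1.
- by rewrite leNgt qm in h.
- have zin : z \in s by rewrite in_cons mem_cat zs !orbT.
  have {}zq : z < u.
    rewrite lt_neqAle zq andbT; apply/eqP => e.
    by move/negP: ugen; apply; rewrite -e.
  have eqz : q.2 = k - z.
    by apply/le_anti; rewrite zv andbT; case: (h3 z zs) => //=; rewrite leNgt zq.
  case: (qxs z zs); first by rewrite eqz eqxx.
  by move=> /(uside _ zin).2; rewrite ltNge (ltW zq).
- have jin l : (l < N)%N -> l \in iota 0 N by move=> ?; rewrite mem_iota.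
  have Din : D j \in s by rewrite in_cons !mem_cat (map_f D (jin _ (ltnW jN))) !orbT.
  have Ain : A j.+1 \in s by rewrite in_cons !mem_cat (map_f A (jin _ jN)) !orbT.
  case: (h4 j jN) => /= h; move/negP: ugen; apply.
    by rewrite (_ : u = D j)//; apply/le_anti; rewrite h Dq.
  by rewrite (_ : u = A j.+1)//; apply/le_anti; rewrite h qA.
Qed.

End Table.

(** * Level sets of the table *)

Lemma le_foldr_min (R : realType) (F v : R) (s : seq R) :
  v <= foldr Num.min F s <-> v <= F /\ forall z, z \in s -> v <= z.
Proof.
elim: s => [|z s IH] /=; first by split=> [|[]].
rewrite le_min; split=> [/andP[vz /IH[vF vs]]|[vF vs]].
  by split=> // z'; rewrite in_cons => /predU1P[->|/vs].
apply/andP; split; first by apply: vs; rewrite mem_head.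
by apply/IH; split=> // z' z's; apply: vs; rewrite in_cons z's orbT.
Qed.

Lemma foldr_min_case (R : realType) (F : R) (s : seq R) :
  foldr Num.min F s = F \/ foldr Num.min F s \in s.
Proof.
elim: s => [|z s [IH|IH]] /=; first by left.
  by rewrite IH minEle; case: ifP => _; [right; rewrite mem_head|left].
by right; rewrite in_cons minEle; case: ifP => _; rewrite ?eqxx// IH orbT.
Qed.

Section Pieces.
Variables (R : realType) (m k : R) (xs : seq R) (N : nat) (A D : nat -> R) (w : R * R).
Hypothesis w_le : w.1 <= m /\ w.2 <= m.
Hypothesis A0 : A 0 = m.
Hypothesis A_lt_D : forall j, A j < D j.
Hypothesis D_lt_A : forall j, D j < A j.+1.
Hypothesis xs_sorted : sorted <%R xs.
Hypothesis xs_corner : forall z, z \in xs -> m < z /\ m < k - z.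
Hypothesis xs_A : forall z j, z \in xs -> z != A j.
Hypothesis xs_D : forall z j, z \in xs -> z != D j.
Notation table := (table m k xs N A D w).
Notation allowed := (allowed m k xs N A D).

Variables (V1 V2 : R -> R).
Hypotheses (cV1 : continuous V1) (cV2 : continuous V2).
Hypothesis V1_le : forall a b, m <= a -> m <= b -> (V1 a <= V1 b) = (a <= b).
Hypothesis V2_le : forall a b, m <= a -> m <= b -> (V2 a <= V2 b) = (a <= b).
(* The turning points, in general position with respect to the table. *)
Variables (E F : R).
Hypotheses (mE : m < E) (mF : m < F).
Hypothesis E_xs : E \notin xs.
Hypothesis E_A : forall j, (j < N)%N -> E != A j.
Hypothesis E_D : forall j, (j < N)%N -> E != D j.
Hypothesis F_xs : forall z, z \in xs -> F != k - z.

Lemma A_lt i j : (i < j)%N -> A i < A j.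
Proof.
elim: j => // j IH; rewrite ltnS leq_eqVlt => /predU1P[->|/IH ij].
  exact: lt_trans (A_lt_D _) (D_lt_A _).
exact: lt_trans (lt_trans ij (A_lt_D _)) (D_lt_A _).
Qed.

Lemma A_le i j : (i <= j)%N -> A i <= A j.
Proof. by rewrite leq_eqVlt => /predU1P[->//|/A_lt/ltW]. Qed.

Lemma D_le i j : (i <= j)%N -> D i <= D j.
Proof.
rewrite leq_eqVlt => /predU1P[->//|ij].
by rewrite (le_trans (ltW (D_lt_A i)))// (le_trans (A_le ij)) ?ltW.
Qed.

Lemma m_le_A j : m <= A j.
Proof. by rewrite -A0 A_le. Qed.

Definition right_edge j := if (j.+1 < N)%N && (D j < E) then D j else E.
(** The corners to the left of the part [j] of the table bound it from above. *)
Definition top_edge j := foldr Num.min F [seq k - z | z <- xs & z < A j].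
(** The reflex corners of the part [j] that the turning lines do not hide. *)
Definition corners j := [seq z <- xs | [&& A j < z, z < right_edge j & k - z < F]].
Definition shown := [seq j <- iota 0 N | A j < E].

Lemma right_edge_case j : right_edge j = E /\ ((j.+1 < N)%N -> E < D j) \/
  [/\ right_edge j = D j, D j < E & (j.+1 < N)%N].
Proof.
rewrite /right_edge; case: ifP => [/andP[jN DE]|h]; first by right.
left; split=> // jN; move: h; rewrite jN /= => /negbT; rewrite -leNgt le_eqVlt.
by rewrite (negPf (E_D (ltnW jN))).
Qed.

Lemma right_le_E j : right_edge j <= E.
Proof. by case: (right_edge_case j) => [[-> _]|[-> /ltW]]. Qed.

Lemma right_le_D j : (j.+1 < N)%N -> right_edge j <= D j.
Proof. by move=> jN; case: (right_edge_case j) => [[-> /(_ jN)/ltW]|[->]]. Qed.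

Lemma A_lt_right j : A j < E -> A j < right_edge j.
Proof. by move=> AE; case: (right_edge_case j) => [[->]|[->]]. Qed.

Lemma le_top j v : v <= top_edge j <-> v <= F /\ forall z, z \in xs -> z < A j -> v <= k - z.
Proof.
rewrite /top_edge le_foldr_min; split=> -[vF h]; split=> //.
  by move=> z zs zA; apply: h; apply: (map_f (fun z => k - z)); rewrite mem_filter zA.
by move=> _ /mapP[z + ->]; rewrite mem_filter => /andP[zA zs]; exact: h.
Qed.

Lemma top_case j : top_edge j = F \/ exists z, [/\ z \in xs, z < A j & top_edge j = k - z].
Proof.
rewrite /top_edge; have [->|/mapP[z + e]] := foldr_min_case F [seq k - z | z <- xs & z < A j].
  by left.
by rewrite mem_filter => /andP[zA zs]; right; exists z.
Qed.

Lemma top_le_F j : top_edge j <= F.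
Proof. by have [] := (le_top j _).1 (lexx (top_edge j)). Qed.

Lemma m_lt_top j : m < top_edge j.
Proof. by case: (top_case j) => [->//|[z [/xs_corner[_ h] _ ->]]]. Qed.

Lemma corners_x_sorted j : A j < E -> sorted <%R (A j :: rcons (corners j) (right_edge j)).
Proof.
move=> AE; rewrite sorted_pairwise; last exact: lt_trans.
rewrite pairwise_cons pairwise_rcons all_rcons A_lt_right//=.
rewrite -sorted_pairwise; last exact: lt_trans.
rewrite sorted_filter ?andbT//; last exact: lt_trans.
by apply/andP; split; apply/allP => z; rewrite mem_filter => /andP[/and3P[]].
Qed.

Lemma corners_y_sorted j :
  sorted >%R (top_edge j :: rcons [seq k - z | z <- corners j] m).
Proof.
have gt_trans : transitive (>%R : rel R) by move=> u v z vu zv; exact: lt_trans zv vu.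
rewrite sorted_pairwise// pairwise_cons pairwise_rcons all_rcons pairwise_map.
apply/and3P; split; first apply/andP; first split.
- exact: m_lt_top.
- apply/allP => _ /mapP[z + ->]; rewrite mem_filter => /andP[/and3P[Az zr zF] zs].
  case: (top_case j) => [->//|[z' [z's z'A ->]]].
  by have : k - z < k - z' by rewrite ltrD2l ltrN2 (lt_trans z'A).
- by apply/allP => _ /mapP[z + ->]; rewrite mem_filter => /andP[_ /xs_corner[]].
apply: (@sub_pairwise _ <%R) => [a b ab|].
  by have : k - b < k - a by rewrite ltrD2l ltrN2.
rewrite -sorted_pairwise; last exact: lt_trans.
by rewrite sorted_filter//; exact: lt_trans.
Qed.

Notation piece_x j := (seq_x (A j) (right_edge j) (corners j)).
Notation piece_y j := (seq_y (top_edge j) m k (corners j)).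
Notation piece j := (stair (size (corners j)) (piece_x j) (piece_y j)).

Lemma piece_allowed j q : (j < N)%N -> piece j q -> [/\ q.1 <= E, q.2 <= F & allowed q].
Proof.
move=> jN /seq_stairP[/andP[Au ur] /andP[mv vt] qs].
have uE : q.1 <= E by rewrite (le_trans ur) ?right_le_E.
have [vF vtop] := (le_top j _).1 vt; split=> //; split=> //.
- exact: le_trans (m_le_A j) Au.
- move=> z zs; have [zA|Az|zA] := ltgtP z (A j).
  + by right; exact: vtop.
  + have [zr|rz] := ltP z (right_edge j); last by left; exact: le_trans rz.
    have [zF|Fz] := ltP (k - z) F; last by right; exact: le_trans Fz.
    by apply: qs; rewrite mem_filter Az zr zF.
  + by have := xs_A j zs; rewrite zA eqxx.
move=> l lN; have [lj|jl] := ltnP l j.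
  by right; exact: le_trans (A_le lj) Au.
left; rewrite (le_trans ur)// (le_trans (right_le_D _)) ?D_le//.
exact: leq_ltn_trans lN.
Qed.

Lemma allowed_piece q : (0 < N)%N -> q.1 <= E -> q.2 <= F -> allowed q ->
  exists2 j, j \in shown & piece j q.
Proof.
move=> N0 uE vF [mu mv qs qgap].
have ex : exists j, (j < N)%N && (A j <= q.1) by exists 0%N; rewrite N0 A0.
have bd j : (j < N)%N && (A j <= q.1) -> (j <= N)%N by case/andP => /ltnW.
(* the last part that starts to the left of [q] *)
case: (ex_maxnP ex bd) => j /andP[jN Aj] jmax.
have AE : A j < E by rewrite lt_neqAle eq_sym E_A// (le_trans Aj).
exists j; first by rewrite mem_filter AE mem_iota.
apply/seq_stairP; split; last by move=> z; rewrite mem_filter => /andP[_ /qs].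
  rewrite Aj /right_edge; case: ifP => // /andP[jN1 _].
  case: (qgap j jN1) => // AS; have := jmax j.+1; rewrite jN1 AS => /(_ isT).
  by rewrite ltnn.
rewrite mv; apply/le_top; split=> // z zs zA.
by case: (qs z zs) => // uz; have := lt_le_trans zA (le_trans Aj uz); rewrite ltxx.
Qed.

Lemma piece_disjoint q i j : (i < N)%N -> (j < N)%N -> piece i q -> piece j q -> i = j.
Proof.
have lt_absurd a b : (a < b)%N -> (b < N)%N -> piece a q -> piece b q -> False.
  move=> ab bN /seq_stairP[/andP[_ ua] _ _] /seq_stairP[/andP[Ab _] _ _].
  have aN : (a.+1 < N)%N by exact: leq_ltn_trans bN.
  have := le_lt_trans (le_trans ua (right_le_D aN)) (D_lt_A a).
  by rewrite ltNge (le_trans (A_le ab)).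
move=> iN jN qi qj; case: (ltngtP i j) => // ij.
- by case: (lt_absurd i j).
- by case: (lt_absurd j i).
Qed.

(** The step at the corner [z] lies up and to the right of the points concerned. *)
Lemma corner_closure q z : z \in xs -> z <= q.1 -> k - z <= q.2 -> closure table q.
Proof.
move=> zs zq kq; apply: (@closure_direction _ _ _ 1 1); near=> t.
have t0 : 0 < t by near: t; exact: nbhs_right_gt.
by apply/tableP => //; constructor 3; exists z; rewrite //= !mulr1; split; lra.
Unshelve. all: by end_near. Qed.

Lemma piece_v_closure j q : j \in shown -> piece j q ->
  vwall (size (corners j)) (piece_x j) (piece_y j) q -> q.1 != E -> closure table q.
Proof.
rewrite mem_filter mem_iota => /andP[AE /= jN] qS /(seq_vwallP qS)[e|e|[z zc [e h]]] qE.
- case: j => [|l] in AE jN qS e *.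
    apply: (@closure_direction _ _ _ (-1) 0); near=> t.
    have t0 : 0 < t by near: t; exact: nbhs_right_gt.
    by apply/tableP => //; constructor 1; rewrite /= e A0 mulrN1; lra.
  have DA : 0 < A l.+1 - D l by rewrite subr_gt0.
  apply: (@closure_direction _ _ _ (-1) 0); near=> t.
  have t0 : 0 < t by near: t; exact: nbhs_right_gt.
  have tD : t < A l.+1 - D l by near: t; exact: nbhs_right_lt.
  by apply/tableP => //; constructor 4; exists l; rewrite //= e mulrN1; apply/andP; split; lra.
- case: (right_edge_case j) => [[rE _]|[rD _ jN1]]; first by rewrite e rE eqxx in qE.
  have DA : 0 < A j.+1 - D j by rewrite subr_gt0.
  apply: (@closure_direction _ _ _ 1 0); near=> t.
  have t0 : 0 < t by near: t; exact: nbhs_right_gt.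
  have tD : t < A j.+1 - D j by near: t; exact: nbhs_right_lt.
  by apply/tableP => //; constructor 4; exists j; rewrite //= e rD mulr1; apply/andP; split; lra.
- by move: zc; rewrite mem_filter => /andP[_ zs]; apply: (corner_closure zs); rewrite ?e.
Unshelve. all: by end_near. Qed.

Lemma piece_h_closure j q : j \in shown -> piece j q ->
  hwall (size (corners j)) (piece_x j) (piece_y j) q -> q.2 != F -> closure table q.
Proof.
rewrite mem_filter mem_iota => /andP[AE /= jN] qS /(seq_hwallP qS)[e|e|[z zc [e h]]] qF.
- apply: (@closure_direction _ _ _ 0 (-1)); near=> t.
  have t0 : 0 < t by near: t; exact: nbhs_right_gt.
  by apply/tableP => //; constructor 2; rewrite /= e mulrN1; lra.
- case: (top_case j) => [tF|[z [zs zA tz]]]; first by rewrite e tF eqxx in qF.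
  have [/andP[Au _] _ _] := (seq_stairP _ _ _ _ _ _ _).1 qS.
  by apply: (corner_closure zs); rewrite ?e ?tz// (le_trans (ltW zA)).
- by move: zc; rewrite mem_filter => /andP[_ zs]; apply: (corner_closure zs); rewrite ?e.
Unshelve. all: by end_near. Qed.

(** The closure lemmas put the sides that are not on turning lines on walls.
    Conversely, at a point off the sides every bound of the table is strict in
    the relevant coordinate: those of the corners in the part by definition, of
    the corners to the left by [top_edge], of the hidden ones by the general
    position of [E] and [F]. *)
Lemma piece_billiard j : j \in shown ->
  billiard_stair V1 V2 table (V1 E) (V2 F) (size (corners j)) (piece_x j) (piece_y j).
Proof.
move=> js; have := js; rewrite mem_filter mem_iota => /andP[AE /= jN].
have px := seq_x_lt (corners_x_sorted AE); have py := seq_y_gt (corners_y_sorted j).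
have out q : piece j q -> ~ table q.
  by move=> qS; apply/table_out => //; have [] := piece_allowed jN qS.
have V1_eq u : m <= u -> V1 u = V1 E -> u = E.
  by move=> mu e; apply/le_anti/andP; split; rewrite -V1_le ?e ?lexx// ltW.
have V2_eq v : m <= v -> V2 v = V2 F -> v = F.
  by move=> mv e; apply/le_anti/andP; split; rewrite -V2_le ?e ?lexx// ltW.
split=> //.
- move=> q qS; have [uE vF [mu mv _ _]] := piece_allowed jN qS.
  by split; [rewrite V1_le// ltW|rewrite V2_le// ltW|exact: out].
- move=> q qS; have [uE vF [mu mv qs qgap]] := piece_allowed jN qS.
  have [/andP[Au ur] /andP[_ vt] _] := (seq_stairP _ _ _ _ _ _ _).1 qS.
  split; last first.
    move=> qw; have [->|uE'] := eqVneq q.1 E; [by right|left].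
    apply: (side_on_vertical px py) => // z zS zw e.
    by apply: (piece_v_closure js) => //; rewrite e.
  case=> [ov|/V1_eq e]; last first.
    apply/seq_vwallP => //; constructor 2; apply/le_anti.
    by rewrite ur e// right_le_E.
  apply: contrapT => nw; move: ov.
  have {}Au : A j < q.1.
    rewrite lt_neqAle Au andbT; apply/eqP => e.
    by apply: nw; apply/seq_vwallP => //; constructor 1.
  have {}ur : q.1 < right_edge j.
    rewrite lt_neqAle ur andbT; apply/eqP => e.
    by apply: nw; apply/seq_vwallP => //; constructor 2.
  apply: not_on_vertical => //.
  + exact: le_lt_trans (m_le_A j) Au.
  + move=> z zs; have [uz|] := eqVneq q.1 z; [right|by left].
    have [zF|Fz] := ltP (k - z) F; last first.
      by apply: (le_lt_trans vF); rewrite lt_neqAle F_xs.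
    rewrite ltNge; apply/negP => zv; apply: nw; apply/seq_vwallP => //.
    by constructor 3; exists z => //; rewrite mem_filter -uz Au ur uz zF.
  + move=> l lN; have [lj|jl] := ltnP l j.
      by right; exact: le_lt_trans (A_le lj) Au.
    left; apply: (lt_le_trans ur); rewrite (le_trans (right_le_D _)) ?D_le//.
    exact: leq_ltn_trans lN.
- move=> q qS; have [uE vF [mu mv qs qgap]] := piece_allowed jN qS.
  have [/andP[Au ur] /andP[_ vt] _] := (seq_stairP _ _ _ _ _ _ _).1 qS.
  split; last first.
    move=> qw; have [->|vF'] := eqVneq q.2 F; [by right|left].
    apply: (side_on_horizontal px py) => // z zS zw e.
    by apply: (piece_h_closure js) => //; rewrite e.
  case=> [ov|/V2_eq e]; last first.
    apply/seq_hwallP => //; constructor 2; apply/le_anti.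
    by rewrite vt e// top_le_F.
  apply: contrapT => nw; move: ov; apply: not_on_horizontal => //.
    rewrite lt_neqAle mv andbT; apply/eqP => e.
    by apply: nw; apply/seq_hwallP => //; constructor 1.
  move=> z zs; have [vz|] := eqVneq q.2 (k - z); [right|by left].
  have {}vt : q.2 < top_edge j.
    rewrite lt_neqAle vt andbT; apply/eqP => e.
    by apply: nw; apply/seq_hwallP => //; constructor 2.
  have [zA|Az|zA] := ltgtP z (A j).
  + have [_ /(_ z zs zA)] := (le_top j _).1 (lexx (top_edge j)).
    by rewrite -vz leNgt vt.
  + have [zr|rz] := ltP z (right_edge j).
      rewrite ltNge; apply/negP => zu; apply: nw; apply/seq_hwallP => //.
      constructor 3; exists z => //; rewrite mem_filter Az zr -vz.
      by rewrite (lt_le_trans vt) ?top_le_F.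
    rewrite lt_neqAle (le_trans ur rz) andbT; apply/eqP => uz.
    have rE : right_edge j = z by apply/le_anti; rewrite rz -uz ur.
    case: (right_edge_case j) => [[rE' _]|[rE' _ _]].
      by move/negP: E_xs; apply; rewrite -rE' rE.
    by have := xs_D j zs; rewrite -rE rE' eqxx.
  + by have := xs_A j zs; rewrite zA eqxx.
Qed.

Theorem table_genera : (0 < N)%N ->
  has_genera R (level_surface V1 V2 table (V1 E) (V2 F))
    [seq (size (corners j)).+1 | j <- shown].
Proof.
move=> N0.
pose nj i := nth 0%N shown i.
have nj_shown i : (i < size shown)%N -> nj i \in shown by move=> ?; rewrite mem_nth.
have nj_lt i : (i < size shown)%N -> (nj i < N)%N.
  by move/nj_shown; rewrite mem_filter mem_iota => /andP[_].
have -> : [seq (size (corners j)).+1 | j <- shown] =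
    mkseq (fun i => (size (corners (nj i))).+1) (size shown).
  apply: (@eq_from_nth _ 0%N); rewrite size_map ?size_mkseq// => i ilt.
  by rewrite (nth_map 0%N)// nth_mkseq.
apply: (@level_surface_genera _ _ _ _ _ _ cV1 cV2 _ (fun i => size (corners (nj i)))
  (fun i => piece_x (nj i)) (fun i => piece_y (nj i))).
- by move=> i ilt; apply: piece_billiard; exact: nj_shown.
- move=> q uE vF nB; have qa : allowed q by apply/(table_out k xs N A D w_le).
  have [mu mv _ _] := qa.
  have {}uE : q.1 <= E by rewrite -V1_le// ltW.
  have {}vF : q.2 <= F by rewrite -V2_le// ltW.
  have [j js jq] := allowed_piece N0 uE vF qa.
  exists (index j shown); first by rewrite index_mem.
  by rewrite /nj nth_index.
- move=> q i i' ilt i'lt qi qi'.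
  have := piece_disjoint (nj_lt _ ilt) (nj_lt _ i'lt) qi qi' => /eqP.
  by rewrite nth_uniq// ?filter_uniq ?iota_uniq// => /eqP.
Qed.

End Pieces.

(** * Potentials *)

Section Potential.
Variables (R : realType) (V : R -> R).
Hypothesis hV : potential V.

Lemma potential_derivable q : derivable V q 1.
Proof. by have := @potential_smooth _ _ hV 0 q; rewrite derive1n0. Qed.

Lemma potential_continuous : continuous V.
Proof. by move=> q; apply/differentiable_continuous/derivable1_diffP/potential_derivable. Qed.

Lemma potential_lt a b : 0 <= a -> a < b -> V a < V b.
Proof.
move=> a0 ab; apply: (@gtr0_derive1_lt_cc _ V a b) => //; rewrite ?in_itv/= ?lexx ?(ltW ab)//.
- by move=> q _; exact: potential_derivable.
- move=> q; rewrite in_itv/= => /andP[aq _]; have q0 := le_lt_trans a0 aq.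
  by have := potential_sign hV (lt0r_neq0 q0); rewrite pmulr_rgt0// derive1n1.
- exact/continuous_subspaceT/potential_continuous.
Qed.

Lemma potential_le m a b : 0 <= m -> m <= a -> m <= b -> (V a <= V b) = (a <= b).
Proof.
move=> m0 ma mb; have [ab|ba|->] := ltgtP a b; last by rewrite lexx.
- by rewrite ltW// potential_lt// (le_trans m0).
- by apply/negbTE; rewrite -ltNge potential_lt// (le_trans m0).
Qed.

Lemma potential_turning a e : V a <= e -> exists2 b, a <= b & V b = e.
Proof.
move=> Va; have /cvgryPge/(_ e) := potential_pinfty hV.
move=> [b0 [_ hb]]; pose b := Num.max a b0 + 1.
have ab : a <= b by rewrite (@le_trans _ _ (Num.max a b0)) ?le_max ?lexx// lerDl.
have Vb : e <= V b.
  apply: hb; rewrite (@le_lt_trans _ _ (Num.max a b0)) ?le_max ?lexx ?orbT//.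
  by rewrite ltrDl.
have [||z] := @IVT _ V a b e ab.
- exact/continuous_subspaceT/potential_continuous.
- by rewrite ge_min Va le_max Vb orbT.
by rewrite in_itv/= => /andP[az _] Vz; exists z.
Qed.

End Potential.

(** * Finiteness of the foliation *)

(** Injective on the lists of at most [N] entries bounded by [K]; this makes their
    finiteness usable to index families. *)
Definition encode_genera (N K : nat) (l : seq nat) : 'I_N.+1 * {ffun 'I_N -> 'I_K.+1} :=
  (inord (size l), [ffun j : 'I_N => inord (nth 0%N l j)]).

Definition decode_genera (N K : nat) (t : 'I_N.+1 * {ffun 'I_N -> 'I_K.+1}) : seq nat :=
  [seq val (t.2 j) | j <- take t.1 (enum 'I_N)].

Lemma encode_generaK (N K : nat) (l : seq nat) :
  (size l <= N)%N -> all (fun z => z <= K)%N l -> decode_genera (encode_genera N K l) = l.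
Proof.
move=> lN /allP lK; rewrite /decode_genera /= inordK//.
have -> : [seq val ([ffun j : 'I_N => inord (nth 0%N l j)] j : 'I_K.+1)
                | j <- take (size l) (enum 'I_N)]
    = [seq nth 0%N l j | j <- [seq val j | j <- take (size l) (enum 'I_N)]].
  rewrite -map_comp; apply: eq_map => j /=; rewrite ffunE inordK// ltnS.
  have [jl|lj] := ltnP j (size l); first by apply/lK/mem_nth.
  by rewrite nth_default.
rewrite map_take val_enum_ord take_iota (minn_idPl lN).
exact: mkseq_nth.
Qed.

(** The leaves outside [crit] are grouped by their genera. Each leaf in [crit] is
    a family by itself, of one kind or the other according to whether it is a
    union of closed surfaces. *)
Lemma finitely_foliated_generic (R : realType) (V1 V2 : R -> R) (B : set (R * R)) (h : R)
    (crit : seq R) (N K : nat) :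
    (forall e1, leaves V1 V2 B h e1 -> e1 \notin crit -> exists l : seq nat,
      [/\ (size l <= N)%N, all (fun z => z <= K)%N l &
          has_genera R (level_surface V1 V2 B e1 (h - e1)) l]) ->
  finitely_foliated V1 V2 B h.
Proof.
move=> generic.
have /choice[gs gsP] : forall e1, exists l : seq nat, leaves V1 V2 B h e1 /\ e1 \notin crit ->
    [/\ (size l <= N)%N, all (fun z => z <= K)%N l &
        has_genera R (level_surface V1 V2 B e1 (h - e1)) l].
  move=> e1; have [[le nc]|nl] := pselect (leaves V1 V2 B h e1 /\ e1 \notin crit).
    by have [l lP] := generic e1 le nc; exists l.
  by exists [::].
pose c := undup crit.
pose I : finType := (('I_N.+1 * {ffun 'I_N -> 'I_K.+1}) + 'I_(size c))%type.
pose J (i : I) : set R := match i with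
  | inl t => [set e1 | [/\ leaves V1 V2 B h e1, e1 \notin crit & encode_genera N K (gs e1) = t]]
  | inr l => leaves V1 V2 B h `&` [set nth 0 c l] end.
exists #|I|, (fun i => J (enum_val i)); split.
- move=> i i' _ _ [e1 [Ji Ji']]; apply: enum_val_inj.
  move: (enum_val i) (enum_val i') Ji Ji' => {i i'} [t|l] [t'|l'] /=.
  + by move=> [_ _ <-] [_ _ <-].
  + by move=> [_ nc _] [_ e]; move: nc; rewrite -mem_undup e mem_nth.
  + by move=> [_ e] [_ nc _]; move: nc; rewrite -mem_undup e mem_nth.
  + move=> [_ ->] [_ /eqP]; rewrite nth_uniq ?undup_uniq// => /eqP ll'.
    by congr inr; apply: val_inj.
- apply/seteqP; split=> [e1 [i _]|e1 le].
    by case: (enum_val i) => [t|l] [].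
  have [ec|nc] := boolP (e1 \in crit).
    have cl : (index e1 c < size c)%N by rewrite index_mem mem_undup.
    exists (enum_rank (inr (Ordinal cl) : I)) => //; rewrite enum_rankK; split=> //=.
    by rewrite nth_index// mem_undup.
  by exists (enum_rank (inl (encode_genera N K (gs e1)) : I)) => //; rewrite enum_rankK.
- move=> i; case: (enum_val i) => [t|l] /=.
    left; exists (decode_genera t) => e1 [le nc <-].
    by have [s1 s2 s3] := gsP e1 (conj le nc); rewrite encode_generaK.
  have [le|nl] := pselect (leaves V1 V2 B h (nth 0 c l)); last first.
    by left; exists [::] => e1 [le e]; case: nl; rewrite -e.
  have -> : leaves V1 V2 B h `&` [set nth 0 c l] = [set nth 0 c l].
    by apply/seteqP; split=> [e1 []//|e1 ->].
  have [[g hg]|ng] := pselect (exists g,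
      has_genera R (level_surface V1 V2 B (nth 0 c l) (h - nth 0 c l)) g).
    by left; exists g => e1 ->.
  by right; exists (nth 0 c l) => // g hg; apply: ng; exists g.
Qed.

Section TableFoliation.
Variables (R : realType) (m k : R) (xs : seq R) (N : nat) (A D : nat -> R) (w : R * R).
Hypothesis w_le : w.1 <= m /\ w.2 <= m.
Hypothesis A0 : A 0 = m.
Hypothesis A_lt_D : forall j, A j < D j.
Hypothesis D_lt_A : forall j, D j < A j.+1.
Hypothesis xs_sorted : sorted <%R xs.
Hypothesis xs_corner : forall z, z \in xs -> m < z /\ m < k - z.
Hypothesis xs_A : forall z j, z \in xs -> z != A j.
Hypothesis xs_D : forall z j, z \in xs -> z != D j.
Hypothesis N0 : (0 < N)%N.
Hypothesis m0 : 0 <= m.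
Variables (V1 V2 : R -> R).
Hypotheses (hV1 : potential V1) (hV2 : potential V2).
Notation table := (table m k xs N A D w).

Lemma table_foliated h : finitely_foliated V1 V2 table h.
Proof.
(* the values at which a turning point meets a corner or a wall *)
pose crit1 := m :: xs ++ [seq A j | j <- iota 0 N] ++ [seq D j | j <- iota 0 N].
pose crit2 := m :: [seq k - z | z <- xs].
pose crit := [seq V1 z | z <- crit1] ++ [seq h - V2 z | z <- crit2].
apply: (@finitely_foliated_generic _ _ _ _ _ crit N (size xs).+1) => e1 [a [h1 h2 nB]] nc.
have [mu mv _ _] := (table_out k xs N A D w_le _).1 nB.
have [E uE VE] := potential_turning hV1 (energy_potential h1).
have [F vF VF] := potential_turning hV2 (energy_potential h2).
have E_gen z : z \in crit1 -> E != z.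
  move=> zc; apply: contraNneq nc => e; rewrite mem_cat -VE e.
  by rewrite (map_f V1 zc).
have F_gen z : z \in crit2 -> F != z.
  move=> zc; apply: contraNneq nc => e; rewrite mem_cat.
  by rewrite (_ : e1 = h - V2 z) ?(map_f (fun z => h - V2 z) zc) ?orbT// -e VF opprB addrC subrK.
exists [seq (size (corners k xs N A D E F j)).+1 | j <- shown N A E]; split.
- by rewrite size_map size_filter (leq_trans (count_size _ _))// size_iota.
- by apply/allP => _ /mapP[j _ ->]; rewrite ltnS size_filter count_size.
rewrite -[e1 in level_surface _ _ _ e1]VE -VF.
have in_iota j : (j < N)%N -> j \in iota 0 N by move=> ?; rewrite mem_iota.
have := @table_genera R m k xs N A D w w_le A0 A_lt_D D_lt_A xs_sorted xs_corner xs_A xs_D V1 V2.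
apply=> //.
- exact: potential_continuous.
- exact: potential_continuous.
- by move=> u v; apply: potential_le.
- by move=> u v; apply: potential_le.
- by rewrite lt_neqAle (le_trans mu uE) andbT eq_sym E_gen ?mem_head.
- by rewrite lt_neqAle (le_trans mv vF) andbT eq_sym F_gen ?mem_head.
- by apply/negP => Exs; have := E_gen E; rewrite in_cons mem_cat Exs orbT eqxx => /(_ isT).
- by move=> j jN; apply: E_gen; rewrite in_cons !mem_cat (map_f A (in_iota _ jN)) !orbT.
- by move=> j jN; apply: E_gen; rewrite in_cons !mem_cat (map_f D (in_iota _ jN)) !orbT.
- by move=> z zs; apply: F_gen; rewrite in_cons (map_f (fun z => k - z) zs) orbT.
Qed.

End TableFoliation.

(** * The table with [N] pieces of genus [g] *)

Section Comb.
Variables (R : realType) (m : R) (g N : nat).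
Notation P := g.+1.

(** With unit length, the [N] parts have width [g], the gaps between them width
    one, and each part has a corner at each of its [g - 1] interior integer
    abscissae. *)
Definition comb_left j : R := m + (j * P)%:R.
Definition comb_right j : R := m + (j * P + g)%:R.
Definition comb_index : seq nat := [seq i <- iota 0 (N * P) | (i %% P != 0)%N && (i %% P != g)%N].
Definition comb_corners : seq R := [seq m + i%:R | i <- comb_index].
Definition comb_height : R := m + m + (N * P)%:R.

Lemma comb_ltE i j : (m + i%:R < m + j%:R :> R) = (i < j)%N.
Proof. by rewrite ltrD2l ltr_nat. Qed.

Lemma comb_eqE i j : (m + i%:R == m + j%:R :> R) = (i == j)%N.
Proof. by rewrite (inj_eq (addrI _)) eqr_nat. Qed.

Lemma comb_left_right j : (0 < g)%N -> comb_left j < comb_right j.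
Proof. by move=> g0; rewrite comb_ltE -[X in (X < _)%N]addn0 ltn_add2l. Qed.

Lemma comb_right_left j : comb_right j < comb_left j.+1.
Proof. by rewrite comb_ltE mulSn addnC ltn_add2r. Qed.

Lemma comb_corners_sorted : sorted <%R comb_corners.
Proof.
apply: (homo_sorted (e := ltn)) => [i j ij|]; first by rewrite comb_ltE.
by apply: sorted_filter; [exact: ltn_trans|exact: iota_ltn_sorted].
Qed.

Lemma comb_cornersP z : z \in comb_corners ->
  exists i, [/\ (i < N * P)%N, (i %% P != 0)%N, (i %% P != g)%N & z = m + i%:R].
Proof.
by move=> /mapP[i + ->]; rewrite mem_filter mem_iota => /andP[/andP[h1 h2] h3]; exists i.
Qed.

Lemma comb_corner z : z \in comb_corners -> m < z /\ m < comb_height - z.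
Proof.
move=> /comb_cornersP[i [iN i0 _ ->]]; split.
  by rewrite ltrDl ltr0n lt0n; apply: contraNneq i0 => ->; rewrite mod0n.
have : i%:R < (N * P)%:R :> R by rewrite ltr_nat.
rewrite /comb_height; lra.
Qed.

Lemma comb_corner_left z j : z \in comb_corners -> z != comb_left j.
Proof.
move=> /comb_cornersP[i [_ i0 _ ->]]; rewrite comb_eqE.
by apply: contraNneq i0 => ->; rewrite modnMl.
Qed.

Lemma comb_corner_right z j : z \in comb_corners -> z != comb_right j.
Proof.
move=> /comb_cornersP[i [_ _ ig ->]]; rewrite comb_eqE.
by apply: contraNneq ig => ->; rewrite modnMDl modn_small.
Qed.

Let E : R := m + (N * P)%:R.

Lemma comb_edge j : (j < N)%N -> comb_left j < E /\ E != comb_right j.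
Proof.
move=> jN; have h : (j.+1 * P <= N * P)%N by rewrite leq_mul2r jN orbT.
rewrite mulSn in h; rewrite comb_ltE comb_eqE; split; first by lia.
by apply/eqP; lia.
Qed.

Lemma comb_shown : shown N comb_left E = iota 0 N.
Proof.
apply/all_filterP/allP => j; rewrite mem_iota => /= jN.
by have [] := comb_edge jN.
Qed.

Hypotheses (g0 : (0 < g)%N) (m1 : 1 <= m).

Lemma comb_corners_size j : (j < N)%N ->
  size (corners comb_height comb_corners N comb_left comb_right E comb_height j) = g.-1.
Proof.
move=> jN; rewrite /corners /comb_corners filter_map size_map.
set s := (X in size X = _); suff -> : s = iota (j * P).+1 g.-1 by rewrite size_iota.
apply: (irr_sorted_eq ltn_trans ltnn).
- apply: sorted_filter; first exact: ltn_trans.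
  by apply: sorted_filter; [exact: ltn_trans|exact: iota_ltn_sorted].
- exact: iota_ltn_sorted.
have hN : (P + j * P <= N * P)%N by rewrite -mulSn leq_mul2r jN orbT.
move=> i; rewrite !mem_filter !mem_iota /= add0n comb_ltE.
have -> : (comb_height - (m + i%:R) < comb_height) = true.
  by rewrite ltrBlDr ltrDl (lt_le_trans ltr01)// (le_trans m1)// lerDl ler0n.
have -> : (m + i%:R < right_edge N comb_right E j) =
    (i < if (j.+1 < N)%N then j * P + g else N * P)%N.
  rewrite /right_edge; have -> : comb_right j < E by rewrite comb_ltE; lia.
  by rewrite andbT; case: ifP => _; rewrite comb_ltE.
rewrite andbT; apply/idP/idP.
  move=> /andP[/andP[ji ir] /andP[/andP[i0 ig] iN]].
  have iP : (i < j * P + P)%N.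
    case: ifP ir => [_|/negbT jN1] h; first by lia.
    by have eN : N = j.+1 by [lia]; move: h; rewrite eN mulSn; lia.
  have ei : i = (j * P + (i - j * P))%N by rewrite subnKC// ltnW.
  move: i0 ig; rewrite ei modnMDl modn_small; last by lia.
  by lia.
move=> /andP[ji ig]; have ei : i = (j * P + (i - j * P))%N by rewrite subnKC// ltnW.
have im : (i %% P = i - j * P)%N by rewrite [in LHS]ei modnMDl modn_small//; lia.
rewrite ji im; apply/andP; split; first by case: ifP; lia.
by apply/andP; split; lia.
Qed.

Lemma comb_genera :
  [seq (size (corners comb_height comb_corners N comb_left comb_right E comb_height j)).+1
     | j <- shown N comb_left E] = nseq N g.
Proof.
rewrite comb_shown; apply: (@eq_from_nth _ 0%N); rewrite size_map size_iota ?size_nseq// => j jN.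
by rewrite (nth_map 0%N) ?size_iota// nth_iota// nth_nseq jN comb_corners_size// prednK.
Qed.

End Comb.

Theorem corollary2p4 (R : realType) (V1 V2 : R -> R) (w : R * R)
    (hV1 : potential V1) (hV2 : potential V2) (hw : w.1 * w.2 != 0)
    (g N : nat) (hg : (1 <= g)%N) (hN : (1 <= N)%N) :
  exists (n : nat) (added : 'I_n -> set (R * R)),
    (forall i, barrier (added i)) /\
    let B := step true true w `|` \bigcup_i added i in
    (exists e1 e2 : R, has_genera R (level_surface V1 V2 B e1 e2) (nseq N g)) /\
    (forall h : R, finitely_foliated V1 V2 B h).
Proof.
(* Beyond [m > 0] the potentials increase; the half-planes up to [m] hide the
   given step. *)
pose m : R := Num.max 1 (Num.max w.1 w.2).
have m1 : 1 <= m by rewrite le_max lexx.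
have m0 : 0 <= m by exact: le_trans ler01 m1.
have w_le : w.1 <= m /\ w.2 <= m by rewrite !le_max !lexx !orbT.
pose k := comb_height m g N; pose xs := comb_corners m g N.
pose A := comb_left m g; pose D := comb_right m g.
have A0 : A 0%N = m by rewrite /A /comb_left mul0n addr0.
have AD j : A j < D j by exact: comb_left_right.
have DA j : D j < A j.+1 by exact: comb_right_left.
pose bs := table_barriers m k xs N A D.
exists (size bs), (fun i => nth set0 bs i); split.
  by move=> i; apply: (table_barriers_barrier DA); exact: ltn_ord.
have -> : step true true w `|` \bigcup_(i : 'I_(size bs)) nth set0 bs i = table m k xs N A D w.
  congr (_ `|` _); apply/seteqP; split=> [q [i _ qi]|q [i ilt qi]].
    by exists i; [exact: ltn_ord|].
  by exists (Ordinal (ilt : (i < size bs)%N)).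
move=> B; split; last first.
  move=> h; apply: table_foliated => //.
  - exact: comb_corners_sorted.
  - by move=> z; apply: comb_corner.
  - by move=> z j; apply: comb_corner_left.
  - by move=> z j; apply: comb_corner_right.
(* [E] is beyond all corners, and [k] is above all of them. *)
pose E : R := m + (N * g.+1)%:R.
exists (V1 E), (V2 k); rewrite -(comb_genera N hg m1).
apply: table_genera => //.
- exact: comb_corners_sorted.
- by move=> z; apply: comb_corner.
- by move=> z j; apply: comb_corner_left.
- by move=> z j; apply: comb_corner_right.
- exact: potential_continuous.
- exact: potential_continuous.
- by move=> u v; apply: potential_le.
- by move=> u v; apply: potential_le.
- by rewrite ltrDl ltr0n muln_gt0 hN.
- by rewrite /k /comb_height -addrA ltrDl ltr_wpDr ?ler0n// (lt_le_trans ltr01).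
- by apply/negP => /comb_cornersP[i [iN _ _ /eqP]]; rewrite comb_eqE eq_sym ltn_eqF.
- by move=> j jN; rewrite gt_eqF//; have [] := comb_edge m g jN.
- by move=> j jN; have [] := comb_edge m g jN.
- by move=> z /comb_corner[mz _]; rewrite gt_eqF// ltrBlDr ltrDl (le_lt_trans m0).
Qed.
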